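(* Let $K$ be the feasible set of (P). Assume that $\mathrm{Ideal}[\tilde c_{\mathcal E}]\subseteq\mathbb R[\tilde x]$ is real radical and $f\ge0$ on $K$. Then: (i) Suppose $K$ is closed at $\infty$ and the degrees of $f$ and $c_i\ (i\in\mathcal I)$ are all even. If the LICQC, SCC and SOSC hold at every minimizer of (P), including every minimizer at infinity, then $(1+\|x\|^2)^kf\in\mathrm{Ideal}[c_{\mathcal E}]+\mathrm{QM}[c_{\mathcal I}]$ for some $k\in\mathbb N$. (ii) Suppose the form $f^{(1)}$ is positive definite in $\mathbb R^n$. If the LICQC, SCC and SOSC hold at every minimizer of (P), then $(1+\|x\|^2)^kf\in\mathrm{Ideal}[c_{\mathcal E}]+\mathrm{QM}[c_{\mathcal I}]$ for some $k\in\mathbb N$.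
   Context: **Problem.** $\mathcal E,\mathcal I$ are disjoint finite label sets; $f,c_i\ (i\in\mathcal E\cup\mathcal I)$ are real polynomials in $x=(x_1,\dots,x_n)$; $d=\deg f$. Problem (P): minimize $f(x)$ subject to $c_i(x)=0\ (i\in\mathcal E)$, $c_j(x)\ge 0\ (j\in\mathcal I)$; $f_{\min}=\inf_Kf$. ''Minimizer'' means global minimizer. $f^{(1)}$ is the homogeneous part of $f$ of highest degree; a form $p$ is positive definite if $p(x)>0$ for all nonzero $x\in\mathbb R^n$. **Homogenization.** $\tilde x=(x_0,x)\in\mathbb R^{n+1}$; $\tilde p(\tilde x)=x_0^{\deg p}p(x/x_0)$. Let $\widetilde K^h=\{\tilde x:\tilde c_i(\tilde x)=0\,(i\in\mathcal E),\ \tilde c_j(\tilde x)\ge0\,(j\in\mathcal I),\ x_0\ge0\}$, $\widetilde K^c=\widetilde K^h\cap\{x_0>0\}$, $\widetilde K=\widetilde K^h\cap\{\|\tilde x\|^2=1\}$. $K$ (with its given description) is closed at $\infty$ if the closure of $\widetilde K^c$ equals $\widetilde K^h$. With $F(\tilde x)=\tilde f(\tilde x)-f_{\min}x_0^d$, a point $x^*\in\mathbb R^n$ is a minimizer at infinity of (P) if $(0,x^* )\in\widetilde K$ and $F(0,x^* )=0$. In part (i) (even degrees), the LICQC, SCC and SOSC are said to hold at a minimizer at infinity $x^*$ if they hold at $(0,x^* )$ for the problem $$\min\ F(\tilde x)\quad\text{s.t.}\quad\tilde c_i(\tilde x)=0\ (i\in\mathcal E),\ \tilde c_j(\tilde x)\ge0\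 (j\in\mathcal I),\ \|\tilde x\|^2-1=0$$ (without the constraint $x_0\ge0$). **Optimality conditions.** For a problem $\min\phi(u)$ s.t. $h_i(u)=0\ (i\in E)$, $h_j(u)\ge0\ (j\in I)$ and a local minimizer $u^*$, let $J(u^* )=\{i\in E\cup I: h_i(u^* )=0\}$. LICQC: the gradients $\nabla h_i(u^* )$, $i\in J(u^* )$, are linearly independent. Under LICQC there are unique multipliers $\lambda_i$ with $\nabla\phi(u^* )=\sum_{i\in E\cup I}\lambda_i\nabla h_i(u^* )$, $\lambda_j\ge0$ and $\lambda_jh_j(u^* )=0$ for $j\in I$. SCC: $\lambda_j+h_j(u^* )>0$ for all $j\in I$. SOSC: $v^T\nabla^2\mathscr L(u^* )v>0$ for all $v\ne0$ orthogonal to all $\nabla h_i(u^* )$, $i\in J(u^* )$, where $\mathscr L=\phi-\sum_i\lambda_ih_i$. **Algebra.** $c_{\mathcal E}=\{c_i\}_{i\in\mathcal E}$, $c_{\mathcal I}=\{c_j\}_{j\in\mathcal I}$, $\tilde c_{\mathcal E}=\{\tilde c_i\}_{i\in\mathcal E}\cup\{\|\tilde x\|^2-1\}$. $\mathrm{Ideal}[h]$ is the ideal generated by $h$ in the corresponding real polynomial ring ($\mathbb R[x]$ for $c_{\mathcal E}$, $\mathbb R[\tilde x]$ for $\tilde c_{\mathcal E}$). It is real radical if it equals the set of all polynomials vanishing on the real zero set of $h$. $\mathrm{QM}[g]=\Sigma[x]+\sum_jg_j\Sigma[x]$, with $\Sigma[x]$ the set of sums of squares of polynomials. *)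

(* Defs.v *)
(* R : realType plays the role of the field of real numbers, and points of R^n
   are row vectors x : 'rV[R]_n, so that the value of a polynomial p at x is
   p.@[x 0]. *)
From HB Require Import structures.
From mathcomp Require Import all_boot all_order all_algebra.
From mathcomp Require Import mpoly.
From mathcomp Require Import boolp classical_sets reals topology normedtype.

Set Implicit Arguments.
Unset Strict Implicit.
Unset Printing Implicit Defensive.

Import Order.TTheory GRing.Theory Num.Theory.
Import numFieldTopology.Exports.

Local Open Scope classical_set_scope.
Local Open Scope ring_scope.

(* The zero polynomial gets degree 0. *)
Definition mtdeg (R : realType) (n : nat) (p : {mpoly R[n]}) : nat :=
  (msize p).-1.

Definition top_form (R : realType) (n : nat) (p : {mpoly R[n]}) : {mpoly R[n]} :=
  pihomog mdeg (mtdeg p) p.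

Definition pos_def_form (R : realType) (n : nat) (p : {mpoly R[n]}) : Prop :=
  forall x : 'rV[R]_n, x != 0 -> 0 < p.@[x 0].

Definition sqnorm (R : realType) (n : nat) : {mpoly R[n]} := \sum_i 'X_i ^+ 2.

(* In {mpoly R[n.+1]}, the variable x_0 is 'X_ord0 and the variable x_i of the
   original ring is 'X_(lift ord0 i). *)
Definition homogenize (R : realType) (n : nat) (p : {mpoly R[n]}) :
    {mpoly R[n.+1]} :=
  \sum_(k < (mtdeg p).+1)
    'X_ord0 ^+ (mtdeg p - k)
    * (pihomog mdeg k p \mPo [tuple 'X_(lift ord0 i) | i < n]).

Lemma homogenizeE (R : realType) (n : nat) (p : {mpoly R[n]})
    (y : 'I_n.+1 -> R) (y0 : y ord0 != 0) :
  (homogenize p).@[y]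
  = y ord0 ^+ mtdeg p * p.@[fun i => y (lift ord0 i) / y ord0].
Proof.
have -> (v : 'I_n -> R) :
    p.@[v] = \sum_(k < (mtdeg p).+1) (pihomog mdeg k p).@[v].
  by rewrite -raddf_sum /= -pihomog_partitionE //; exact: leqSpred.
rewrite /homogenize raddf_sum /= mulr_sumr.
apply: eq_bigr => k _; rewrite mevalM rmorphXn /= mevalXU comp_mpoly_meval.
rewrite (meval_eq (v2 := fun i => y (lift ord0 i))); last first.
  by move=> i; rewrite tnth_mktuple mevalXU.
rewrite !mevalE !mulr_sumr big_seq [RHS]big_seq; apply: eq_bigr => m mS.
have /dhomogP/(_ m mS) /= dm := pihomogP mdeg k p.
rewrite mulrCA [RHS]mulrCA; congr (_ * _).
under [in RHS]eq_bigr do rewrite exprMn exprVn.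
rewrite big_split /= prodfV prodrXr -mdegE dm mulrCA mulrC; congr (_ * _).
by rewrite expfB_cond // (negbTE y0) add0n -ltnS.
Qed.

Definition ideal_gen (R : realType) (n : nat) (I : finType)
    (h : I -> {mpoly R[n]}) : set {mpoly R[n]} :=
  [set p | exists a : I -> {mpoly R[n]}, p = \sum_i a i * h i].

Definition real_radical (R : realType) (n : nat) (I : finType)
    (h : I -> {mpoly R[n]}) : Prop :=
  ideal_gen h =
  [set p | forall x : 'rV[R]_n, (forall i, (h i).@[x 0] = 0) -> p.@[x 0] = 0].

Definition sos (R : realType) (n : nat) : set {mpoly R[n]} :=
  [set p | exists s : seq {mpoly R[n]}, p = \sum_(q <- s) q ^+ 2].

Definition QM (R : realType) (n : nat) (I : finType)
    (g : I -> {mpoly R[n]}) : set {mpoly R[n]} :=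
  [set p | exists2 s0, sos s0 & exists2 s : I -> {mpoly R[n]},
     (forall j, sos (s j)) & p = s0 + \sum_j g j * s j].

(* Equality and inequality constraints are indexed by two separate types, so
   that the whole family of constraints is indexed by the disjoint sum. *)
Record problem (R : realType) (n : nat) (E I : finType) := Problem {
  obj : {mpoly R[n]};
  eqc : E -> {mpoly R[n]};
  ineqc : I -> {mpoly R[n]} }.

Definition constr (R : realType) (n : nat) (E I : finType)
    (P : problem R n E I) (i : E + I) : {mpoly R[n]} :=
  match i with inl e => eqc P e | inr j => ineqc P j end.

Definition feasible (R : realType) (n : nat) (E I : finType)
    (P : problem R n E I) : set 'rV[R]_n :=
  [set x | (forall i, (eqc P i).@[x 0] = 0)
           /\ (forall j, 0 <= (ineqc P j).@[x 0])].

Definition minimizer (R : realType) (n : nat) (E I : finType)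
    (P : problem R n E I) : set 'rV[R]_n :=
  [set x | feasible P x
           /\ forall y, feasible P y -> (obj P).@[x 0] <= (obj P).@[y 0]].

(* This is the genuine infimum when the feasible set is nonempty and the
   objective is bounded below on it; otherwise inf has the value 0. *)
Definition fmin (R : realType) (n : nat) (E I : finType)
    (P : problem R n E I) : R :=
  inf [set (obj P).@[x 0] | x in feasible P].

Definition grad (R : realType) (n : nat) (p : {mpoly R[n]}) (u : 'rV[R]_n) :
    'rV[R]_n := \row_i (p^`M(i)).@[u 0].

Definition hessian (R : realType) (n : nat) (p : {mpoly R[n]}) (u : 'rV[R]_n) :
    'M[R]_n := \matrix_(i, j) (p^`M(i)^`M(j)).@[u 0].

Definition active (R : realType) (n : nat) (E I : finType)
    (P : problem R n E I) (u : 'rV[R]_n) : {set E + I} :=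
  [set i | (constr P i).@[u 0] == 0]%SET.

Definition LICQC (R : realType) (n : nat) (E I : finType)
    (P : problem R n E I) (u : 'rV[R]_n) : Prop :=
  free [seq grad (constr P i) u | i in active P u].

Definition lagrange_multiplier (R : realType) (n : nat) (E I : finType)
    (P : problem R n E I) (u : 'rV[R]_n) (lam : E + I -> R) : Prop :=
  [/\ grad (obj P) u = \sum_i lam i *: grad (constr P i) u,
      forall j : I, 0 <= lam (inr j)
    & forall j : I, lam (inr j) * (ineqc P j).@[u 0] = 0].

Definition SCC (R : realType) (n : nat) (E I : finType)
    (P : problem R n E I) (u : 'rV[R]_n) (lam : E + I -> R) : Prop :=
  forall j : I, 0 < lam (inr j) + (ineqc P j).@[u 0].

Definition lagrangian (R : realType) (n : nat) (E I : finType)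
    (P : problem R n E I) (lam : E + I -> R) : {mpoly R[n]} :=
  obj P - \sum_i lam i *: constr P i.

Definition SOSC (R : realType) (n : nat) (E I : finType)
    (P : problem R n E I) (u : 'rV[R]_n) (lam : E + I -> R) : Prop :=
  forall v : 'rV[R]_n, v != 0 ->
    (forall i, i \in active P u -> v *m (grad (constr P i) u)^T = 0) ->
    0 < (v *m hessian (lagrangian P lam) u *m v^T) 0 0.

(* LICQC makes the multiplier vector unique (and, at a local minimizer, it
   exists), so "exists lam" selects the vector of Lagrange multipliers. *)
Definition optimality_conditions (R : realType) (n : nat) (E I : finType)
    (P : problem R n E I) (u : 'rV[R]_n) : Prop :=
  LICQC P u /\
  exists lam, [/\ lagrange_multiplier P u lam, SCC P u lam & SOSC P u lam].

Definition homog_feasible (R : realType) (n : nat) (E I : finType)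
    (P : problem R n E I) : set 'rV[R]_n.+1 :=
  [set y | [/\ forall i, (homogenize (eqc P i)).@[y 0] = 0,
               forall j, 0 <= (homogenize (ineqc P j)).@[y 0]
             & 0 <= y 0 ord0]].

Definition homog_feasible_pos (R : realType) (n : nat) (E I : finType)
    (P : problem R n E I) : set 'rV[R]_n.+1 :=
  homog_feasible P `&` [set y | 0 < y 0 ord0].

Definition homog_feasible_sphere (R : realType) (n : nat) (E I : finType)
    (P : problem R n E I) : set 'rV[R]_n.+1 :=
  homog_feasible P `&` [set y | \sum_i y 0 i ^+ 2 = 1].

Definition closed_at_infinity (R : realType) (n : nat) (E I : finType)
    (P : problem R n E I) : Prop :=
  closure (homog_feasible_pos P) = homog_feasible P.

(* None indexes the sphere constraint. *)
Definition homog_eqc (R : realType) (n : nat) (E : finType)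
    (c : E -> {mpoly R[n]}) (i : option E) : {mpoly R[n.+1]} :=
  match i with None => sqnorm R n.+1 - 1 | Some e => homogenize (c e) end.

Definition homog_problem (R : realType) (n : nat) (E I : finType)
    (P : problem R n E I) : problem R n.+1 (option E) I :=
  Problem (homogenize (obj P) - fmin P *: 'X_ord0 ^+ mtdeg (obj P))
          (homog_eqc (eqc P)) (fun j => homogenize (ineqc P j)).

Definition at_infinity (R : realType) (n : nat) (x : 'rV[R]_n) : 'rV[R]_n.+1 :=
  row_mx (0 : 'rV[R]_1) x.

Definition minimizer_at_infinity (R : realType) (n : nat) (E I : finType)
    (P : problem R n E I) : set 'rV[R]_n :=
  [set x | homog_feasible_sphere P (at_infinity x)
           /\ (obj (homog_problem P)).@[at_infinity x 0] = 0].

(* Main.v *)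
(* Homogenize. On the unit sphere of R^(n+1) the polynomial F = f~ - fmin x_0^d
   is nonnegative on the set S cut out by the homogenized constraints (made of
   even degree by a factor x_0 where needed), and a certificate of F in the
   quadratic module M of S yields one for f by substituting
   (x_0, x) = (1, x) / sqrt (1 + |x|^2) and clearing denominators.

   At a zero u of F the multipliers, SCC and SOSC give F = tau + G with tau in M
   and G vanishing to second order at u with positive definite Hessian; for
   u_0 <> 0 Euler's identities transfer these conditions from the minimizer
   u' / u_0 of (P). Such a G is a sum of squares plus \sum_j (X_j - u_j)^2 c_j
   with c_j(u) > 0; absorb the squares into tau. Let t = 1 - <u, X>, which is
   |X - u|^2 / 2 on the sphere, and let B = 1 - t w be a square close to 0 away
   from u and vanishing at the other zeros of F. Then
     F = B F + t w F = B tau + \sum_j (X_j - u_j)^2 (B c_j + (w / 2) F)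
   modulo |X|^2 - 1, and each coefficient B c_j + (w / 2) F is nonnegative on S,
   has one zero less than F and inherits the local decompositions. Induction on
   the number of zeros ends with Putinar's theorem. The latter is reduced, by
   a penalty for the constraints, to strict positivity on [-1, 1]^(n+1), where
   Bernstein expansions apply since
   2 (1 + X_i) = (1 + X_i)^2 + \sum_(j <> i) X_j^2 modulo |X|^2 - 1, and
   similarly for 1 - X_i. *)
Require Import Defs.
From HB Require Import structures.
From mathcomp Require Import all_boot all_order all_algebra.
From mathcomp Require Import mpoly ring lra zify.
From mathcomp Require Import boolp classical_sets reals topology normedtype.

Set Implicit Arguments.
Unset Strict Implicit.
Unset Printing Implicit Defensive.

Import Order.TTheory GRing.Theory Num.Theory.
Import numFieldTopology.Exports numFieldNormedType.Exports.

Local Open Scope classical_set_scope.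
Local Open Scope ring_scope.

(** * Compactness and continuity of polynomial functions *)

(** As [F] vanishes at its minimizers, Putinar's theorem does not apply to [F] itself, and the local
    identity F = tau + \sum_j (X_j - u_j)^2 c_j is no certificate because c_j is known to be
    positive only near u. Splitting F = B F + (1 - B) F repairs this: where B is small, the share (w
    / 2) F outweighs B c_j. The demands on B are as follows. It is a square, so B tau stays in M; w
    is at least 1/2 on the sphere, so multiplication by w / 2 preserves M. At every other zero x of
    F it vanishes to order four: order two makes it comparable with the quadratic growth of F at x,
    and order three already leaves the second-order data at x untouched, so x keeps a local
    certificate. Elsewhere it decays geometrically. The set S does not include x_0 >= 0, so x_0 may
    be negative; even degrees make all signs agree with those at the affine point x / x_0. Points
    with x_0 = 0 are the only place where closedness at infinity or positive definiteness of the top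
    form enters. Even degrees matter again on the way back, where sqrt (1 + |x|^2) has to disappear
    from the certificate. *)

Lemma mevalXn (R : comNzRingType) n (v : 'I_n -> R) (p : {mpoly R[n]}) k :
  (p ^+ k).@[v] = p.@[v] ^+ k.
Proof. exact: rmorphXn. Qed.

Lemma meval_sum (R : comNzRingType) n (v : 'I_n -> R) (J : Type) (r : seq J)
    (P : pred J) (F : J -> {mpoly R[n]}) :
  (\sum_(i <- r | P i) F i).@[v] = \sum_(i <- r | P i) (F i).@[v].
Proof. exact: raddf_sum. Qed.

Section Compactness.
Context (R : realType).
Implicit Types (n : nat).

(** If [Q S] failed, the sets [A] with [Q (S \ A)] would form a proper filter containing [S], and
    the local hypothesis at a cluster point would be contradicted. This replaces finite subcovers
    below: thresholds and lower bounds found locally become uniform. *)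
Lemma compact_ind (T : topologicalType) (S : set T) (Q : set T -> Prop) :
  compact S -> Q set0 -> (forall A B, A `<=` B -> Q B -> Q A) ->
  (forall A B, Q A -> Q B -> Q (A `|` B)) ->
  (forall x, S x -> exists2 U, nbhs x U & Q (S `&` U)) -> Q S.
Proof.
move=> cS Q0 Qsub QU Qloc; apply: contrapT => nQS.
pose F : set_system T := [set A | Q (S `\` A)].
have FF : ProperFilter F.
  split; first by rewrite /F /= setD0.
  split; rewrite /F /=.
  - by rewrite setDT.
  - move=> A B QA QB; change (Q (S `\` (A `&` B))); rewrite setDIr; exact: QU.
  - by move=> A B AB; apply: Qsub; exact: setDS.
have FS : F S by change (Q (S `\` S)); rewrite setDv.
have [x [Sx clx]] := cS F FF FS.
have [U Ux QSU] := Qloc x Sx.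
have FU : F (~` U) by change (Q (S `\` ~` U)); rewrite setDE setCK.
have [y [nUy Uy]] := clx (~` U) U FU Ux.
exact: nUy.
Qed.

Lemma meval_cvg n (p : {mpoly R[n]}) (y : 'rV[R]_n) :
  (fun z : 'rV[R]_n => p.@[z 0] : R) @ y --> (p.@[y 0] : R).
Proof.
have Fy : Filter (nbhs y) := nbhs_filter y.
elim/mpolyind: p => [|c m p _ _ IH].
  have -> : (fun z : 'rV_n => 0.@[z 0] : R) = fun=> 0 :> R.
    by apply/funext => z; rewrite meval0.
  by rewrite meval0; exact: (@cvg_cst R 0 _ (nbhs y) Fy).
have -> : (fun z : 'rV_n => (c *: 'X_[m] + p).@[z 0] : R)
    = fun z => c * \prod_i z 0 i ^+ m i + p.@[z 0].
  by apply/funext => z; rewrite mevalD mevalZ mevalX.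
rewrite mevalD mevalZ mevalX; apply: (@cvgD R R) => //.
apply: (@cvgM R); first exact: (@cvg_cst R c _ (nbhs y) Fy).
apply: (@cvg_big R) => [|i _]; first exact: mul_continuous.
elim: (m i) => [|k IHk].
  have -> : (fun z : 'rV_n => z 0 i ^+ 0) = fun=> 1 :> R.
    by apply/funext => z; rewrite expr0.
  by rewrite expr0; exact: (@cvg_cst R 1 _ (nbhs y) Fy).
have -> : (fun z : 'rV_n => z 0 i ^+ k.+1) = fun z => (z 0 i * z 0 i ^+ k : R).
  by apply/funext => z; rewrite exprS.
by rewrite exprS; apply: (@cvgM R) => //; exact: coord_continuous.
Qed.

Lemma mpoly_continuous n (p : {mpoly R[n]}) :
  continuous (fun y : 'rV[R]_n => p.@[y 0] : R).
Proof. by move=> y; exact: meval_cvg. Qed.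

Lemma meval_near_gt n (p : {mpoly R[n]}) (u : 'rV[R]_n) a :
  a < p.@[u 0] -> nbhs u [set y : 'rV[R]_n | a < p.@[y 0]].
Proof. by move=> h; apply: (cvgr_gt _ (@meval_cvg n p u)). Qed.

Lemma meval_near_lt n (p : {mpoly R[n]}) (u : 'rV[R]_n) a :
  p.@[u 0] < a -> nbhs u [set y : 'rV[R]_n | p.@[y 0] < a].
Proof. by move=> h; apply: (cvgr_lt _ (@meval_cvg n p u)). Qed.

Lemma meval_near_bounded n (p : {mpoly R[n]}) (u : 'rV[R]_n) :
  nbhs u [set y : 'rV[R]_n | `|p.@[y 0]| <= `|p.@[u 0]| + 1].
Proof.
have h1 := @meval_near_gt n p u (p.@[u 0] - 1) ltac:(lra).
have h2 := @meval_near_lt n p u (p.@[u 0] + 1) ltac:(lra).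
apply: filterS (filterI h1 h2) => y [/= y1 y2].
have := ler_norm (p.@[u 0]); have := ler_norm (- p.@[u 0]).
by rewrite normrN ler_norml => *; apply/andP; split; lra.
Qed.

Lemma box_compact n (a b : R) : compact [set y : 'rV[R]_n | forall i, a <= y 0 i <= b].
Proof.
have := @rV_compact R n (fun _ => `[a, b]%classic) (fun _ => @segment_compact _ _ _).
by congr compact; apply/seteqP; split => y /= h i; have := h i; rewrite in_itv.
Qed.

Lemma compact_min n (p : {mpoly R[n]}) (S : set 'rV[R]_n) :
  compact S -> (forall y, S y -> 0 < p.@[y 0]) ->
  exists2 e, 0 < e & forall y, S y -> e <= p.@[y 0].
Proof.
move=> cS pS; pose Q (A : set 'rV[R]_n) := exists2 e, 0 < e & forall y, A y -> e <= p.@[y 0].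
change (Q S); apply: compact_ind cS _ _ _ _ => //.
- by exists 1.
- by move=> A B AB [e e0 h]; exists e => // y /AB /h.
- move=> A B [a a0 hA] [b b0 hB]; exists (Num.min a b); first by rewrite lt_min a0.
  by move=> y [/hA|/hB] h; rewrite ge_min h ?orbT.
move=> x /pS px; exists [set y : 'rV_n | p.@[x 0] / 2 < p.@[y 0]].
  by apply: meval_near_gt; lra.
by exists (p.@[x 0] / 2); [lra | move=> y [_ /ltW]].
Qed.

Lemma zero_locus_closed n (I : finType) (h : I -> {mpoly R[n]}) :
  closed [set y : 'rV[R]_n | forall i, (h i).@[y 0] = 0].
Proof.
rewrite (_ : [set _ | _] = \bigcap_(i in setT) [set y : 'rV[R]_n | (h i).@[y 0] = 0]).
  apply: closed_bigI => i _.
  apply: (@closed_comp _ _ (fun y : 'rV[R]_n => (h i).@[y 0]) [set 0]).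
    by move=> y _; exact: mpoly_continuous.
  exact: closed_eq.
by apply/seteqP; split => y /= H i; [move=> _; exact: H | exact: H].
Qed.

Lemma nonneg_locus_closed n (I : finType) (g : I -> {mpoly R[n]}) :
  closed [set y : 'rV[R]_n | forall i, 0 <= (g i).@[y 0]].
Proof.
rewrite (_ : [set _ | _] = \bigcap_(i in setT) [set y : 'rV[R]_n | 0 <= (g i).@[y 0]]).
  apply: closed_bigI => i _.
  apply: (@closed_comp _ _ (fun y : 'rV[R]_n => (g i).@[y 0]) [set x | 0 <= x]).
    by move=> y _; exact: mpoly_continuous.
  exact: closed_ge.
by apply/seteqP; split => y /= H i; [move=> _; exact: H | exact: H].
Qed.

End Compactness.

(** * Bernstein expansions and positivity on a box *)

Lemma mul_bin_ffact d m k : (m <= k <= d)%N ->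
  ('C(d, k) * k ^_ m = d ^_ m * 'C(d - m, k - m))%N.
Proof.
move=> /andP[mk kd]; have md := leq_trans mk kd.
have h1 := bin_fact kd; have h2 := ffact_fact mk; have h3 := ffact_fact md.
have /bin_fact h4 : (k - m <= d - m)%N by exact: leq_sub2r.
have e : (d - m - (k - m) = d - k)%N by lia.
rewrite e in h4.
have := muln_gt0 (k - m)`! (d - k)`!; rewrite !fact_gt0 /= => pos.
apply/eqP; rewrite -(eqn_pmul2r pos); apply/eqP.
transitivity d`!; last by rewrite -h3 -h4 !mulnA.
by rewrite -h1 -h2 !mulnA.
Qed.

Section Bernstein.
Context (R : realType).

Lemma norm_prodB (I : finType) (a b : I -> R) :
  (forall i, 0 <= a i <= 1) -> (forall i, 0 <= b i <= 1) ->
  `|\prod_i a i - \prod_i b i| <= \sum_i `|a i - b i|.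
Proof.
move=> ha hb.
(* The unit bounds travel with the estimate: they keep the telescoping factors from enlarging the
   differences. *)
pose K x y s := [/\ 0 <= x <= 1, 0 <= y <= 1 & `|x - y| <= s :> R].
suff [] : K (\prod_i a i) (\prod_i b i) (\sum_i `|a i - b i|) by [].
apply: (big_rec3 K) => [|i x y s _ [hx hy hs]].
  by rewrite /K subrr normr0 lexx ler01 lexx.
have /andP[a0 a1] := ha i; have /andP[b0 b1] := hb i.
move: hx hy => /andP[x0 x1] /andP[y0 y1]; split.
- by rewrite mulr_ge0 //= mulr_ile1.
- by rewrite mulr_ge0 //= mulr_ile1.
apply: (@le_trans _ _ (`|(a i - b i) * x| + `|b i * (x - y)|)).
  by rewrite (_ : _ - _ = (a i - b i) * x + b i * (x - y)) ?ler_normD //; ring.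
rewrite !normrM (ger0_norm x0) (ger0_norm b0) lerD //.
  by rewrite -[leRHS]mulr1 ler_wpM2l.
by rewrite (le_trans _ hs) // -[leRHS]mul1r ler_wpM2r.
Qed.

(** This is C(k, m) / C(d, m), the Bernstein coefficient of x^m in degree d. As a quotient of
    falling factorials it is a product of factors (k - i) / (d - i), comparable one by one with k /
    d. *)
Definition bern_coef (d m k : nat) : R := (k ^_ m)%:R / (d ^_ m)%:R.

Lemma bern_coef_bound d m k : (k <= d)%N -> (m <= d)%N -> (0 < d)%N ->
  0 <= bern_coef d m k <= 1 /\
  `|bern_coef d m k - (k%:R / d%:R) ^+ m| <= (m * m)%:R / d%:R.
Proof.
move=> kd md d0.
have dR : 0 < d%:R :> R by rewrite ltr0n.
have -> : bern_coef d m k = \prod_(i < m) ((k - i)%:R / (d - i)%:R).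
  by rewrite /bern_coef !ffact_prod !natr_prod prodf_div.
have -> : (k%:R / d%:R) ^+ m = \prod_(i < m) (k%:R / d%:R) :> R.
  by rewrite prodr_const card_ord.
have f01 (i : 'I_m) : 0 <= ((k - i)%:R / (d - i)%:R : R) <= 1.
  have di : 0 < (d - i)%:R :> R by rewrite ltr0n subn_gt0 (leq_trans (ltn_ord i)).
  apply/andP; split; first by apply: divr_ge0; exact: ler0n.
  by rewrite ler_pdivrMr // mul1r ler_nat leq_sub2r.
split.
  apply: (big_ind (fun x : R => 0 <= x <= 1)) => [|x y|i _] //.
  - by rewrite ler01 lexx.
  - by move=> /andP[x0 x1] /andP[y0 y1]; rewrite mulr_ge0 //= mulr_ile1.
have kd1 : 0 <= (k%:R / d%:R : R) <= 1.
  apply/andP; split; first by apply: divr_ge0; exact: ler0n.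
  by rewrite ler_pdivrMr // mul1r ler_nat.
apply: le_trans (norm_prodB f01 (fun _ => kd1)) _.
apply: le_trans (_ : \sum_(i < m) m%:R / d%:R <= _); last first.
  by rewrite sumr_const card_ord natrM -[leLHS]mulr_natl mulrA.
apply: ler_sum => i _.
have im := ltn_ord i.
have di : 0 < (d - i)%:R :> R by rewrite ltr0n subn_gt0 (leq_trans im).
have imR : i%:R <= m%:R :> R by rewrite ler_nat ltnW.
have kdR : k%:R <= d%:R :> R by rewrite ler_nat.
(* For k < i the truncated subtraction makes the factor 0, and its distance to k / d is then at most
   i / d. *)
have [ik|ki] := leqP i k; last first.
  have -> : (k - i = 0)%N by apply/eqP; rewrite subn_eq0 ltnW.
  rewrite mul0r sub0r normrN ger0_norm ?divr_ge0 ?ler0n //.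
  by rewrite ler_pM2r ?invr_gt0 // (le_trans _ imR) // ler_nat ltnW.
have ide : (i <= d)%N by rewrite (leq_trans ik).
rewrite !natrB // in di *.
rewrite distrC ger0_norm; last first.
  rewrite subr_ge0 ler_pdivrMr // mulrAC ler_pdivlMr //.
  have : 0 <= i%:R * (d%:R - k%:R) :> R by rewrite mulr_ge0 ?ler0n ?subr_ge0.
  lra.
rewrite lerBlDl -lerBlDr -mulrBl ler_pdivrMr // mulrAC ler_pdivlMr //.
have i0 : 0 <= i%:R :> R by exact: ler0n.
have ikR : i%:R <= k%:R :> R by rewrite ler_nat.
have : 0 <= (m%:R - i%:R) * (d%:R - i%:R) :> R by apply: mulr_ge0; lra.
have : 0 <= i%:R * (k%:R - i%:R) :> R by apply: mulr_ge0; lra.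
lra.
Qed.

Definition bern_poly (A : comAlgType R) (d k : nat) (x : A) : A :=
  'C(d, k)%:R *: (x ^+ k * (1 - x) ^+ (d - k)).

(** Multiply x^m by ((1 - x) + x)^(d - m) and expand; the terms with k < m carry a zero falling
    factorial. *)
Lemma bern_expand (A : comAlgType R) (x : A) (d m : nat) : (m <= d)%N ->
  x ^+ m = \sum_(k < d.+1) bern_coef d m k *: bern_poly d k x.
Proof.
move=> md.
rewrite -(big_mkord xpredT (fun k => bern_coef d m k *: bern_poly d k x)).
rewrite (big_cat_nat _ (n := m)) //= 1?(leq_trans md) //.
rewrite big_nat big1 ?add0r => [|k /andP[_ km]]; last first.
  by rewrite /bern_coef ffact_small // mul0r scale0r.
rewrite -[X in \sum_(X <= _ < _) _]add0n big_addn subSn //.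
transitivity (x ^+ m * ((1 - x) + x) ^+ (d - m)).
  by rewrite subrK expr1n mulr1.
rewrite exprDn mulr_sumr big_mkord; apply: eq_bigr => i _.
have id : (i <= d - m)%N by rewrite -ltnS.
rewrite /bern_coef /bern_poly scalerA mulrAC -natrM.
rewrite [(_ ^_ _ * _)%N]mulnC mul_bin_ffact ?leq_addl /=; last by lia.
rewrite addnK natrM mulrAC divff; last first.
  by rewrite pnatr_eq0 -lt0n ffact_gt0.
rewrite mul1r scaler_nat mulrnAr; congr (_ *+ _).
have -> : (d - (i + m) = d - m - i)%N by lia.
by rewrite exprD; ring.
Qed.

End Bernstein.

(** The Bernstein coefficients of [P] in degree d differ from the values of [P] on the grid of mesh
    1 / d by O(1 / d), so they are nonnegative for large d. The basis polynomials are products of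
    the [x i] and [1 - x i], hence lie in [T]. *)
Lemma bernstein_closure (R : realType) (n k : nat) (P : {mpoly R[n]})
    (x : 'I_n -> {mpoly R[k]}) (T : set {mpoly R[k]}) :
  T 0 -> T 1 -> (forall p q, T p -> T q -> T (p + q)) ->
  (forall p q, T p -> T q -> T (p * q)) ->
  (forall c p, 0 <= c -> T p -> T (c *: p)) ->
  (forall i, T (x i)) -> (forall i, T (1 - x i)) ->
  (forall y : 'rV[R]_n, (forall i, 0 <= y 0 i <= 1) -> 0 < P.@[y 0]) ->
  T (P \mPo [tuple x i | i < n]).
Proof.
move=> T0 T1 TD TM TZ Tx Tx1 Ppos.
have [e e0 Pe] := compact_min (@box_compact R n 0 1) Ppos.
pose C : R := \sum_(m <- msupp P) `|P@_m| * \sum_i (m i * m i)%:R.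
have C0 : 0 <= C by apply: sumr_ge0 => m _; rewrite mulr_ge0 ?sumr_ge0.
(* The first summand exceeds every exponent occurring in [P]; the second brings the error C / d
   below the minimum e. *)
pose d := (msize P + (Num.bound (C / e)).+1)%N.
have dpos : (0 < d)%N by rewrite /d addnS.
have dR : 0 < d%:R :> R by rewrite ltr0n.
have Ced : C / d%:R <= e.
  rewrite ler_pdivrMr // mulrC -ler_pdivrMr //.
  apply: le_trans (ltW (archi_boundP (divr_ge0 C0 (ltW e0)))) _.
  by rewrite ler_nat /d addnS ltnW // ltnS leq_addl.
have md m i : m \in msupp P -> (m i <= d)%N.
  move=> /msize_mdeg_lt mP; rewrite (leq_trans _ (leq_addr _ _)) //.
  by rewrite (leq_trans _ (ltnW mP)) // mdegE (bigD1 i) //= leq_addr.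
pose b (f : {ffun 'I_n -> 'I_d.+1}) : R :=
  \sum_(m <- msupp P) P@_m * \prod_i bern_coef R d (m i) (f i).
have -> : P \mPo [tuple x i | i < n]
    = \sum_(f : {ffun 'I_n -> 'I_d.+1}) b f *: \prod_i bern_poly d (f i) (x i).
  rewrite comp_mpolyEX.
  transitivity (\sum_(m <- msupp P) \sum_(f : {ffun 'I_n -> 'I_d.+1})
     (P@_m * \prod_i bern_coef R d (m i) (f i)) *: \prod_i bern_poly d (f i) (x i)).
    rewrite big_seq [RHS]big_seq; apply: eq_bigr => m mP.
    rewrite comp_mpolyX.
    under eq_bigr do rewrite tnth_mktuple (bern_expand _ (md _ _ mP)).
    rewrite bigA_distr_bigA scaler_sumr; apply: eq_bigr => f _.
    by rewrite scaler_prod scalerA.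
  by rewrite exchange_big; apply: eq_bigr => f _; rewrite scaler_suml.
apply: (big_ind T) => // f _; apply: (TZ); last first.
  apply: (big_ind T) => // i _; apply: TZ => //.
  have TX q j : T q -> T (q ^+ j).
    by move=> Tq; elim: j => [|j IH]; rewrite ?expr0 // exprS; exact: TM.
  by apply: TM; exact: TX.
pose y : 'rV[R]_n := \row_i ((f i)%:R / d%:R).
have fd i : (f i <= d)%N by rewrite -ltnS.
have ey : e <= P.@[y 0].
  apply: Pe => i; rewrite mxE divr_ge0 ?ler0n //= ler_pdivrMr // mul1r ler_nat //.
have : `|b f - P.@[y 0]| <= C / d%:R.
  rewrite mevalE -sumrB mulr_suml; apply: le_trans (ler_norm_sum _ _ _) _.
  rewrite big_seq [leRHS]big_seq; apply: ler_sum => m mP.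
  rewrite -mulrBr normrM -mulrA ler_wpM2l //.
  apply: le_trans (norm_prodB _ _) _.
  - by move=> i; case: (bern_coef_bound R (fd i) (md _ i mP) dpos).
  - move=> i; rewrite mxE; apply/andP; split.
      by apply: exprn_ge0; apply: divr_ge0; exact: ler0n.
    apply: exprn_ile1; first by apply: divr_ge0; exact: ler0n.
    by rewrite ler_pdivrMr // mul1r ler_nat.
  rewrite mulr_suml; apply: ler_sum => i _; rewrite mxE.
  by case: (bern_coef_bound R (fd i) (md _ i mP) dpos).
rewrite ler_norml => /andP[h _].
lra.
Qed.

Lemma box_closure (R : realType) (n : nat) (P : {mpoly R[n]}) (T : set {mpoly R[n]}) :
  T 0 -> T 1 -> (forall p q, T p -> T q -> T (p + q)) ->
  (forall p q, T p -> T q -> T (p * q)) ->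
  (forall c p, 0 <= c -> T p -> T (c *: p)) ->
  (forall i, T (1 + 'X_i)) -> (forall i, T (1 - 'X_i)) ->
  (forall y : 'rV[R]_n, (forall i, -1 <= y 0 i <= 1) -> 0 < P.@[y 0]) ->
  T P.
Proof.
move=> T0 T1 TD TM TZ Tx Tx1 Ppos.
pose z : n.-tuple {mpoly R[n]} := [tuple 2%:R *: 'X_i - 1 | i < n].
pose x i : {mpoly R[n]} := 2%:R^-1 *: (1 + 'X_i).
have -> : P = (P \mPo z) \mPo [tuple x i | i < n].
  rewrite -[LHS]comp_mpoly_id [LHS]comp_mpolyE [P \mPo z]comp_mpolyE raddf_sum; apply: eq_bigr => m _ /=.
  rewrite comp_mpolyZ rmorph_prod; congr (_ *: _); apply: eq_bigr => i _.
  rewrite rmorphXn /= !tnth_mktuple; congr (_ ^+ _).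
  rewrite comp_mpolyB comp_mpolyZ comp_mpolyXU comp_mpoly1 -tnth_nth tnth_mktuple.
  by rewrite scalerA divff ?pnatr_eq0 // scale1r [1 + _]addrC addrK.
apply: bernstein_closure => //.
- by move=> i; apply: TZ => //; rewrite invr_ge0 ler0n.
- move=> i; rewrite (_ : 1 - x i = 2%:R^-1 *: (1 - 'X_i)).
    by apply: TZ => //; rewrite invr_ge0 ler0n.
  rewrite /x; apply: (scalerI (a := 2%:R)); first by rewrite pnatr_eq0.
  by rewrite scalerBr !scalerA divff ?pnatr_eq0 // !scale1r scaler_nat; ring.
move=> y hy; rewrite comp_mpoly_meval.
rewrite (meval_eq (v2 := (\row_i (2%:R * y 0 i - 1) : 'rV[R]_n) 0)).
  by apply: Ppos => i; rewrite mxE; have := hy i; lra.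
by move=> i; rewrite tnth_mktuple mxE mevalB mevalZ mevalXU meval1.
Qed.

(** * Sums of squares, ideals and quadratic modules *)

Section QuadraticModule.
Context (R : realType) (n : nat).
Implicit Types p q s : {mpoly R[n]}.

Lemma sos_sq q : sos (q ^+ 2).
Proof. by exists [:: q]; rewrite big_seq1. Qed.

Lemma sos0 : sos (0 : {mpoly R[n]}).
Proof. by exists [::]; rewrite big_nil. Qed.

Lemma sosD p q : sos p -> sos q -> sos (p + q).
Proof. by move=> [s ->] [t ->]; exists (s ++ t); rewrite big_cat. Qed.

Lemma sosM p q : sos p -> sos q -> sos (p * q).
Proof.
move=> [s ->] [t ->]; rewrite mulr_suml.
elim: s => [|a s IH]; first by rewrite big_nil; exact: sos0.
rewrite big_cons; apply: sosD => //; rewrite mulr_sumr.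
elim: t {IH} => [|b t IH]; first by rewrite big_nil; exact: sos0.
by rewrite big_cons -exprMn; apply: sosD => //; exact: sos_sq.
Qed.

Lemma sosC c : 0 <= c -> sos (c%:MP_[n] : {mpoly R[n]}).
Proof. by move=> c0; rewrite -(sqr_sqrtr c0) rmorphXn; exact: sos_sq. Qed.

Lemma sos1 : sos (1 : {mpoly R[n]}).
Proof. by rewrite -mpolyC1; apply: sosC. Qed.

Lemma sosZ c p : 0 <= c -> sos p -> sos (c *: p).
Proof. by move=> c0 sp; rewrite -mul_mpolyC; apply: sosM => //; exact: sosC. Qed.

Lemma sos_sum (J : Type) (r : seq J) (P : pred J) (F : J -> {mpoly R[n]}) :
  (forall i, P i -> sos (F i)) -> sos (\sum_(i <- r | P i) F i).
Proof. by move=> h; apply: big_ind => //; [exact: sos0 | exact: sosD]. Qed.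

Lemma sos_ge0 p (y : 'rV[R]_n) : sos p -> 0 <= p.@[y 0].
Proof.
move=> [s ->]; rewrite meval_sum; apply: sumr_ge0 => q _.
by rewrite mevalXn; exact: sqr_ge0.
Qed.

Section Ideal.
Context (E : finType) (h : E -> {mpoly R[n]}).

Lemma ideal0 : ideal_gen h 0.
Proof. by exists (fun=> 0); under eq_bigr do rewrite mul0r; rewrite big1_eq. Qed.

Lemma idealD p q : ideal_gen h p -> ideal_gen h q -> ideal_gen h (p + q).
Proof.
move=> [a ->] [b ->]; exists (fun i => a i + b i); rewrite -big_split.
by apply: eq_bigr => i _; rewrite mulrDl.
Qed.

Lemma idealM q p : ideal_gen h p -> ideal_gen h (q * p).
Proof.
move=> [a ->]; exists (fun i => q * a i); rewrite mulr_sumr.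
by apply: eq_bigr => i _; rewrite mulrA.
Qed.

Lemma idealZ c p : ideal_gen h p -> ideal_gen h (c *: p).
Proof. by move=> hp; rewrite -mul_mpolyC; exact: idealM. Qed.

Lemma idealN p : ideal_gen h p -> ideal_gen h (- p).
Proof. by rewrite -mulN1r; exact: idealM. Qed.

Lemma idealB p q : ideal_gen h p -> ideal_gen h q -> ideal_gen h (p - q).
Proof. by move=> hp hq; apply: idealD => //; exact: idealN. Qed.

Lemma ideal_mem i : ideal_gen h (h i).
Proof.
exists (fun k => (k == i)%:R); rewrite (bigD1 i) //= eqxx mul1r.
by rewrite big1 ?addr0 // => k /negbTE ->; rewrite mul0r.
Qed.

Lemma ideal_sum (J : Type) (r : seq J) (P : pred J) (F : J -> {mpoly R[n]}) :
  (forall i, P i -> ideal_gen h (F i)) -> ideal_gen h (\sum_(i <- r | P i) F i).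
Proof. by move=> H; apply: big_ind => //; [exact: ideal0 | exact: idealD]. Qed.

Lemma ideal_vanish p (y : 'rV[R]_n) :
  ideal_gen h p -> (forall i, (h i).@[y 0] = 0) -> p.@[y 0] = 0.
Proof.
move=> [a ->] hy; rewrite meval_sum big1 // => i _.
by rewrite /= mevalM hy mulr0.
Qed.

End Ideal.

Section Module.
Context (E I : finType) (h : E -> {mpoly R[n]}) (g : I -> {mpoly R[n]}).

Definition qmodule : set {mpoly R[n]} :=
  [set p | exists a b, [/\ ideal_gen h a, QM g b & p = a + b]].

Definition semialg_set : set 'rV[R]_n :=
  [set y | (forall i, (h i).@[y 0] = 0) /\ (forall j, 0 <= (g j).@[y 0])].

Lemma qmoduleD p q : qmodule p -> qmodule q -> qmodule (p + q).
Proof.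
move=> [a [_ [ha [s0 hs0 [s hs ->]] ->]]] [b [_ [hb [t0 ht0 [t ht ->]] ->]]].
exists (a + b), (s0 + t0 + \sum_j g j * (s j + t j)); split.
- exact: idealD.
- exists (s0 + t0); first exact: sosD.
  by exists (fun j => s j + t j) => // j; exact: sosD.
- by under [in RHS]eq_bigr do rewrite mulrDr; rewrite big_split /=; ring.
Qed.

Lemma qmodule_ideal p : ideal_gen h p -> qmodule p.
Proof.
move=> hp; exists p, 0; split; rewrite ?addr0 //.
exists 0; first exact: sos0.
exists (fun=> 0) => [j|]; first exact: sos0.
by rewrite add0r big1 // => j _; rewrite mulr0.
Qed.

Lemma qmodule_sos p : sos p -> qmodule p.
Proof.
move=> hp; exists 0, p; split; rewrite ?add0r //; first exact: ideal0.
exists p => //; exists (fun=> 0) => [j|]; first exact: sos0.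
by rewrite big1 ?addr0 // => j _; rewrite mulr0.
Qed.

Lemma qmodule_ineq j s : sos s -> qmodule (g j * s).
Proof.
move=> hs; exists 0, (g j * s); split; rewrite ?add0r //; first exact: ideal0.
exists 0; first exact: sos0.
exists (fun k => if k == j then s else 0) => [k|].
  by case: eqP => // _; exact: sos0.
rewrite add0r (bigD1 j) //= eqxx big1 ?addr0 // => k /negbTE ->.
by rewrite mulr0.
Qed.

Lemma qmoduleM s p : sos s -> qmodule p -> qmodule (s * p).
Proof.
move=> hs [a [_ [ha [s0 hs0 [t ht ->]] ->]]].
exists (s * a), (s * s0 + \sum_j g j * (s * t j)); split.
- exact: idealM.
- exists (s * s0); first exact: sosM.
  by exists (fun j => s * t j) => // j; exact: sosM.
- rewrite !mulrDr mulr_sumr; congr (_ + (_ + _)); apply: eq_bigr => j _; ring.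
Qed.

Lemma qmoduleZ c p : 0 <= c -> qmodule p -> qmodule (c *: p).
Proof. by move=> c0 hp; rewrite -mul_mpolyC; apply: qmoduleM => //; exact: sosC. Qed.

Lemma qmodule_sum (J : Type) (r : seq J) (P : pred J) (F : J -> {mpoly R[n]}) :
  (forall i, P i -> qmodule (F i)) -> qmodule (\sum_(i <- r | P i) F i).
Proof.
move=> H; apply: big_ind => //; last exact: qmoduleD.
by apply: qmodule_sos; exact: sos0.
Qed.

Lemma qmodule_ge0 p (y : 'rV[R]_n) : qmodule p -> semialg_set y -> 0 <= p.@[y 0].
Proof.
move=> [a [_ [ha [s0 hs0 [s hs ->]] ->]]] [hy gy].
rewrite mevalD (ideal_vanish ha hy) add0r mevalD; apply: addr_ge0; first exact: sos_ge0.
rewrite meval_sum; apply: sumr_ge0 => j _.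
by rewrite mevalM; apply: mulr_ge0 => //; exact: sos_ge0.
Qed.

End Module.

(* The preordering [sos + Ideal h], which acts on every quadratic module
   containing [h]. *)
Definition sos_mod (E : finType) (h : E -> {mpoly R[n]}) : set {mpoly R[n]} :=
  [set p | exists2 s, sos s & ideal_gen h (p - s)].

Section SosMod.
Context (E I : finType) (h : E -> {mpoly R[n]}) (g : I -> {mpoly R[n]}).

Lemma sos_mod_sos p : sos p -> sos_mod h p.
Proof. by exists p => //; rewrite subrr; exact: ideal0. Qed.

Lemma sos_mod_ideal p q : ideal_gen h p -> sos_mod h q -> sos_mod h (p + q).
Proof. by move=> hp [s hs qs]; exists s => //; rewrite -addrA; exact: idealD. Qed.

Lemma sos_modD p q : sos_mod h p -> sos_mod h q -> sos_mod h (p + q).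
Proof.
move=> [s hs ps] [t ht qt]; exists (s + t); first exact: sosD.
by rewrite opprD addrACA; exact: idealD.
Qed.

Lemma sos_modM p q : sos_mod h p -> sos_mod h q -> sos_mod h (p * q).
Proof.
move=> [s hs ps] [t ht qt]; exists (s * t); first exact: sosM.
rewrite (_ : _ - _ = q * (p - s) + s * (q - t)); last by ring.
by apply: idealD; exact: idealM.
Qed.

Lemma sos_modZ c p : 0 <= c -> sos_mod h p -> sos_mod h (c *: p).
Proof.
move=> c0 [s hs ps]; exists (c *: s); first exact: sosZ.
by rewrite -scalerBr; exact: idealZ.
Qed.

Lemma qmodule_sos_mod p : sos_mod h p -> qmodule h g p.
Proof.
move=> [s hs ps]; rewrite -[p](subrK s); apply: qmoduleD.
  exact: qmodule_ideal.
exact: qmodule_sos.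
Qed.

Lemma qmoduleM_sos_mod p q : sos_mod h p -> qmodule h g q -> qmodule h g (p * q).
Proof.
move=> [s hs ps] hq; rewrite -[p](subrK s) mulrDl; apply: qmoduleD.
  by apply: qmodule_ideal; rewrite mulrC; exact: idealM.
exact: qmoduleM.
Qed.

Lemma box_pos_sos_mod p : ideal_gen h (sqnorm R n - 1) ->
  (forall y : 'rV[R]_n, (forall i, -1 <= y 0 i <= 1) -> 0 < p.@[y 0]) ->
  sos_mod h p.
Proof.
move=> hsph.
have lin (e : R) i : e ^+ 2 = 1 -> sos_mod h (1 + e *: 'X_i).
  move=> e1.
  have -> : 1 + e *: 'X_i = 2%:R^-1 *: (2%:R *: (1 + e *: 'X_i) : {mpoly R[n]}).
    by rewrite scalerA mulVf ?pnatr_eq0 // scale1r.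
  apply: sos_modZ; first by rewrite invr_ge0 ler0n.
  exists ((1 + e *: 'X_i) ^+ 2 + \sum_(j | j != i) 'X_j ^+ 2).
    by apply: sosD; [exact: sos_sq | apply: sos_sum => j _; exact: sos_sq].
  rewrite (_ : _ - _ = - (sqnorm R n - 1)); first exact: idealN.
  have := exprZn e 'X_i 2; rewrite e1 scale1r => a2.
  by rewrite /sqnorm [in RHS](bigD1 i) //= -a2 scaler_nat; ring.
apply: box_closure.
- by apply: sos_mod_sos; exact: sos0.
- by apply: sos_mod_sos; exact: sos1.
- exact: sos_modD.
- exact: sos_modM.
- exact: sos_modZ.
- by move=> i; have := lin 1 i (expr1n _ _); rewrite scale1r.
- by move=> i; have := lin (-1) i; rewrite sqrrN expr1n scaleN1r; exact.
Qed.

End SosMod.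
End QuadraticModule.

(** * Putinar's Positivstellensatz on the sphere *)

Section Putinar.
Context (R : realType) (n : nat) (E I : finType).
Implicit Types (h : E -> {mpoly R[n]}) (g : I -> {mpoly R[n]}).

Lemma bernoulli_ineq (m : nat) (x : R) : 0 <= x -> 1 + m%:R * x <= (1 + x) ^+ m.
Proof.
move=> x0; elim: m => [|m IH]; first by rewrite mul0r addr0 expr0.
rewrite exprS mulrDl mul1r -natr1 mulrDl.
have : 0 <= m%:R * x by rewrite mulr_ge0.
have : 0 <= x * ((1 + x) ^+ m - (1 + m%:R * x)) by rewrite mulr_ge0 ?subr_ge0.
have : 0 <= x * (m%:R * x) by rewrite !mulr_ge0.
rewrite mul1r; lra.
Qed.

(** For x > 0, Bernoulli's inequality gives k x (1 - x)^k <= (1 + x)^k (1 - x)^k <= 1. The doubled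
    exponent makes the power a square, as needed when it serves as the multiplier of a
    constraint. *)
Lemma mul_geom_le (x : R) (k : nat) : x <= 1 -> (0 < k)%N ->
  x * (1 - x) ^+ (k + k) <= k%:R^-1.
Proof.
move=> x1 k0; have kR : 0 < k%:R :> R by rewrite ltr0n.
have sq0 : 0 <= (1 - x) ^+ (k + k) by rewrite exprn_ge0 // subr_ge0.
have [xn|xp] := leP x 0.
  by apply: (@le_trans _ _ 0); [rewrite mulr_le0_ge0 | rewrite invr_ge0 ltW].
have x0 := ltW xp.
have e1 : (1 - x) ^+ k <= 1 by apply: exprn_ile1; lra.
have e2 : (1 - x) ^+ k * (1 + x) ^+ k <= 1.
  rewrite -exprMn; apply: exprn_ile1; first by apply: mulr_ge0; lra.
  by have := sqr_ge0 x; lra.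
have e0 : 0 <= (1 - x) ^+ k by rewrite exprn_ge0 // subr_ge0.
have e3 : k%:R * x * (1 - x) ^+ k <= 1.
  apply: le_trans e2; rewrite mulrC ler_wpM2l //.
  by apply: le_trans (bernoulli_ineq k x0); rewrite lerDr.
rewrite -[leRHS]mul1r ler_pdivlMr // exprD.
have := ler_pM _ _ e3 e1; rewrite mulr1 => /(_ _ e0) H.
apply: le_trans (H _); last by rewrite !mulr_ge0.
by rewrite le_eqVlt; apply/orP; left; apply/eqP; ring.
Qed.

(* For [m] large the penalty exceeds [-p] where a constraint is violated, while
   [m * x * (1 - x) ^ (2 m^2) <= 1 / m] keeps it negligible where all hold. *)
Definition penalty h g (m : nat) : {mpoly R[n]} :=
  m%:R *: \sum_i h i ^+ 2 - m%:R *: \sum_j g j * (1 - g j) ^+ (m * m + m * m).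

Lemma meval_penalty h g m (y : 'rV[R]_n) :
  (penalty h g m).@[y 0]
  = m%:R * \sum_i (h i).@[y 0] ^+ 2
    - \sum_j m%:R * ((g j).@[y 0] * (1 - (g j).@[y 0]) ^+ (m * m + m * m)).
Proof.
rewrite mevalB !mevalZ !meval_sum; congr (_ - _).
  by congr (_ * _); apply: eq_bigr => i _; rewrite mevalXn.
by rewrite mulr_sumr; apply: eq_bigr => j _; rewrite mevalM mevalXn mevalB meval1.
Qed.

Lemma penalty_pos h g (p : {mpoly R[n]}) (B : set 'rV[R]_n) : compact B ->
  (forall y, B y -> forall j, (g j).@[y 0] <= 1) ->
  (forall y, B y -> semialg_set h g y -> 0 < p.@[y 0]) ->
  exists m, forall y, B y -> 0 < (p + penalty h g m).@[y 0].
Proof.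
move=> cB g1 pos.
(* All m beyond a threshold are demanded, so that the thresholds of two pieces combine by taking the
   maximum. *)
pose Q (A : set 'rV[R]_n) := exists m0, forall m, (m0 <= m)%N -> forall y,
  A y -> B y -> 0 < (p + penalty h g m).@[y 0].
suff [m H] : Q B by exists m => y By; exact: H.
pose N : R := #|I|%:R.
have N0 : 0 <= N by exact: ler0n.
(* Here d measures how far some constraint is violated at y, with d = 0 when no violation is
   claimed, and N / m bounds the total contribution of the inequality terms that work against
   positivity. Near an infeasible point m d wins; near a feasible one c > 0 does. *)
have lb (m : nat) (y : 'rV[R]_n) (c d : R) : (0 < m)%N -> B y -> 0 <= d ->
    c < p.@[y 0] ->
    [\/ exists i, d <= (h i).@[y 0] ^+ 2, exists j, (g j).@[y 0] <= - d | d = 0] ->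
    c + m%:R * d - N / m%:R < (p + penalty h g m).@[y 0].
  move=> m0 By d0 cp alt; rewrite mevalD meval_penalty.
  have mR : 0 < m%:R :> R by rewrite ltr0n.
  have term j : m%:R * ((g j).@[y 0] * (1 - (g j).@[y 0]) ^+ (m * m + m * m)) <= m%:R^-1.
    have mm : (0 < m * m)%N by rewrite muln_gt0 m0.
    apply: le_trans (ler_wpM2l (ltW mR) (mul_geom_le (g1 _ By j) mm)) _.
    by rewrite natrM invfM mulrA mulfV ?gt_eqF // mul1r.
  have sumN (P : pred I) : \sum_(j | P j) m%:R * ((g j).@[y 0]
      * (1 - (g j).@[y 0]) ^+ (m * m + m * m)) <= N / m%:R.
    apply: (@le_trans _ _ (\sum_(j | P j) m%:R^-1)); first exact: ler_sum.
    rewrite sumr_const -[leLHS]mulr_natl ler_pM2r ?invr_gt0 // ler_nat.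
    exact: max_card.
  have hsum : 0 <= \sum_i (h i).@[y 0] ^+ 2 by apply: sumr_ge0 => i _; exact: sqr_ge0.
  have mh : 0 <= m%:R * \sum_i (h i).@[y 0] ^+ 2 by rewrite mulr_ge0 // ltW.
  case: alt => [[i hi]|[j gj]|->]; last by have := sumN xpredT; lra.
    have : m%:R * d <= m%:R * \sum_i (h i).@[y 0] ^+ 2.
      rewrite ler_pM2l // (bigD1 i) //=.
      have : 0 <= \sum_(j | j != i) (h j).@[y 0] ^+ 2 by apply: sumr_ge0 => *; exact: sqr_ge0.
      lra.
    by have := sumN xpredT; lra.
  rewrite (bigD1 j) //=; have := sumN (predC1 j) => /= sN.
  suff : m%:R * ((g j).@[y 0] * (1 - (g j).@[y 0]) ^+ (m * m + m * m)) <= - (m%:R * d) by lra.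
  rewrite -mulrN ler_pM2l //.
  have : 1 <= (1 - (g j).@[y 0]) ^+ (m * m + m * m) by rewrite exprn_ege1 //; lra.
  move=> ge1; have : 0 <= - (g j).@[y 0] * ((1 - (g j).@[y 0]) ^+ (m * m + m * m) - 1).
    by apply: mulr_ge0; lra.
  lra.
have big (a b : R) : 0 < b -> exists m0, forall m, (m0 <= m)%N -> a < m%:R * b.
  move=> b0; exists (Num.bound `|a / b|) => m mm.
  rewrite -ltr_pdivrMr //; apply: le_lt_trans (ler_norm _) _.
  apply: lt_le_trans (archi_boundP (normr_ge0 _)) _.
  by rewrite ler_nat.
apply: compact_ind cB _ _ _ _ => //.
- by exists 0%N.
- by move=> A A' AA' [m H]; exists m => k mk y /AA'; exact: H.
- move=> A A' [m H] [m' H']; exists (maxn m m') => k; rewrite geq_max => /andP[mk mk'] y [Ay|Ay].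
    exact: H.
  exact: H'.
move=> x Bx.
have viol (U : set 'rV[R]_n) d : nbhs x U -> 0 < d -> (forall y, U y ->
    [\/ exists i, d <= (h i).@[y 0] ^+ 2, exists j, (g j).@[y 0] <= - d | d = 0]) ->
    exists2 U, nbhs x U & Q (B `&` U).
  move=> Ux d0 HU; exists (U `&` [set y : 'rV[R]_n | p.@[x 0] - 1 < p.@[y 0]]).
    by apply: filterI => //; apply: meval_near_gt; lra.
  have [m0 Hm0] := big (N + 1 - p.@[x 0]) d d0.
  exists m0.+1 => m mm y [_ [Uy py]] By.
  have := lb m y (p.@[x 0] - 1) d _ By (ltW d0) py (HU y Uy).
  have m1 : 1 <= m%:R :> R by rewrite ler1n (leq_ltn_trans _ mm).
  have : N / m%:R <= N by rewrite ler_pdivrMr ?ler_peMr // (lt_le_trans _ m1).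
  have := Hm0 m (ltnW mm) => h1 h2 /(_ (leq_ltn_trans (leq0n _) mm)); lra.
have [/existsP[i hi]|/existsPn hx] := boolP [exists i, (h i).@[x 0] != 0].
  have d0 : 0 < (h i ^+ 2).@[x 0] / 2.
    by rewrite divr_gt0 // mevalXn lt0r sqr_ge0 expf_eq0 /= andbT.
  apply: (viol _ _ _ d0); first by apply: (@meval_near_gt _ _ (h i ^+ 2) x ((h i ^+ 2).@[x 0] / 2)); lra.
  by move=> y /= hy; constructor 1; exists i; rewrite -mevalXn ltW.
have [/existsP[j gj]|/existsPn gx] := boolP [exists j, (g j).@[x 0] < 0].
  have d0 : 0 < - ((g j).@[x 0] / 2) by lra.
  apply: (viol _ _ _ d0); first by apply: (@meval_near_lt _ _ (g j) x ((g j).@[x 0] / 2)); lra.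
  by move=> y /= gy; constructor 2; exists j; rewrite opprK ltW.
have px : 0 < p.@[x 0].
  apply: pos => //; split => [i|j]; first by apply/eqP; have := hx i; rewrite negbK.
  by rewrite leNgt.
exists [set y : 'rV[R]_n | p.@[x 0] / 2 < p.@[y 0]].
  by apply: meval_near_gt; lra.
have [m0 Hm0] := big N (p.@[x 0] / 2) ltac:(lra).
exists m0.+1 => m mm y [_ /= py] By.
have mpos : (0 < m)%N by exact: leq_ltn_trans (leq0n _) mm.
have := lb m y _ 0 mpos By (lexx _) py; rewrite mulr0 addr0 => /(_ _) H.
apply: le_lt_trans (H _); last by constructor 3.
by rewrite subr_ge0 ler_pdivrMr ?ltr0n // mulrC ltW // Hm0 // ltnW.
Qed.

Lemma qmodule_scale h g (c : I -> R) p : (forall j, 0 < c j) ->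
  qmodule h (fun j => c j *: g j) p -> qmodule h g p.
Proof.
move=> c0 [a [_ [ha [s0 hs0 [s hs ->]] ->]]].
rewrite addrA; apply: qmoduleD; last first.
  apply: qmodule_sum => j _; rewrite -scalerAl; apply: qmoduleZ; first exact: ltW.
  exact: qmodule_ineq.
by apply: qmoduleD; [exact: qmodule_ideal | exact: qmodule_sos].
Qed.

(** Adding the penalty makes p positive on the whole box, hence a member of the preordering;
    subtracting it again stays in the module, because its equality part lies in the ideal and each
    (1 - g_j)^(2 m^2) is a square. *)
Theorem putinar h g p : ideal_gen h (sqnorm R n - 1) ->
  (forall y, semialg_set h g y -> 0 < p.@[y 0]) -> qmodule h g p.
Proof.
move=> hsph pos; pose B := [set y : 'rV[R]_n | forall i, -1 <= y 0 i <= 1].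
have cB : compact B by exact: box_compact.
(* The penalty estimate requires g_j <= 1 on the box. Positive rescaling achieves this and is undone
   by [qmodule_scale]. *)
have bnd j : exists2 c, 0 < c & forall y, B y -> c * (g j).@[y 0] <= 1.
  pose Q (A : set 'rV[R]_n) := exists2 c, 0 < c & forall y, A y -> c * (g j).@[y 0] <= 1.
  change (Q B); apply: compact_ind cB _ _ _ _ => //.
  - by exists 1.
  - by move=> A A' AA' [c c0 H]; exists c => // y /AA'; exact: H.
  - move=> A A' [c c0 H] [c' c0' H']; exists (Num.min c c'); first by rewrite lt_min c0.
    have c00 : 0 <= Num.min c c' by rewrite le_min !ltW.
    move=> y Ay; have [gy|gy] := leP (g j).@[y 0] 0.
      by rewrite (le_trans _ ler01) // mulr_ge0_le0.
    case: Ay => [/H|/H']; apply: le_trans; rewrite ler_pM2r // ge_min lexx ?orbT //.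
  move=> x Bx; exists [set y : 'rV[R]_n | (g j).@[y 0] < `|(g j).@[x 0]| + 1].
    by apply: meval_near_lt; rewrite (le_lt_trans (ler_norm _)) // ltrDl.
  exists (`|(g j).@[x 0]| + 1)^-1; first by rewrite invr_gt0 ltr_wpDl.
  by move=> y [_ /= /ltW gy]; rewrite mulrC ler_pdivrMr ?mul1r // ltr_wpDl.
have /choice[c Hc] : forall j, exists c, 0 < c /\ forall y, B y -> c * (g j).@[y 0] <= 1.
  by move=> j; have [c c0 H] := bnd j; exists c.
apply: (@qmodule_scale _ _ c) => [j|]; first by case: (Hc j).
pose g' j := c j *: g j.
have SS y : semialg_set h g' y -> semialg_set h g y.
  move=> [hy gy]; split=> // j; have := gy j; rewrite mevalZ pmulr_rge0 //.
  by case: (Hc j).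
have [|y _ /SS /pos //|m Hm] := @penalty_pos h g' p B cB.
  by move=> y By j; rewrite mevalZ; case: (Hc j) => _; exact.
rewrite -[p](addrK (penalty h g' m)); apply: qmoduleD.
  by apply: qmodule_sos_mod; exact: box_pos_sos_mod.
rewrite opprB addrC; apply: qmoduleD.
  apply: qmodule_ideal; apply: idealN; apply: idealZ; apply: ideal_sum => i _.
  by rewrite expr2; apply: idealM; exact: ideal_mem.
apply: qmoduleZ => //; apply: qmodule_sum => j _; apply: qmodule_ineq.
by rewrite exprD -expr2; exact: sos_sq.
Qed.

End Putinar.

(** * Directional derivatives and nondegenerate zeros *)

Section DirectionalDerivative.
Context (R : realType) (n : nat).
Implicit Types (p q : {mpoly R[n]}) (u v : 'rV[R]_n).

(** The result stays a polynomial, so second derivatives are iterates and Leibniz and Euler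
    identities are algebraic. *)
Definition dird v p : {mpoly R[n]} := \sum_i v 0 i *: p^`M(i).

Lemma dird_is_linear v : linear (dird v).
Proof.
move=> c p q; rewrite /dird scaler_sumr -big_split; apply: eq_bigr => i _ /=.
by rewrite mderivD mderivZ scalerDr !scalerA mulrC.
Qed.

HB.instance Definition _ v :=
  GRing.isLinear.Build R {mpoly R[n]} {mpoly R[n]} _ (dird v) (dird_is_linear v).

Lemma dird_sum v (J : Type) (r : seq J) (P : pred J) (F : J -> {mpoly R[n]}) :
  dird v (\sum_(i <- r | P i) F i) = \sum_(i <- r | P i) dird v (F i).
Proof. exact: raddf_sum. Qed.

Lemma dird2_sum v (J : Type) (r : seq J) (P : pred J) (F : J -> {mpoly R[n]}) :
  dird v (dird v (\sum_(i <- r | P i) F i))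
  = \sum_(i <- r | P i) dird v (dird v (F i)).
Proof.
apply: (big_morph (fun p => dird v (dird v p))) => [p q|]; last by rewrite !raddf0.
by rewrite !raddfD.
Qed.

Lemma dirdD v p q : dird v (p + q) = dird v p + dird v q.
Proof. exact: raddfD. Qed.

Lemma dirdB v p q : dird v (p - q) = dird v p - dird v q.
Proof. exact: raddfB. Qed.

Lemma dirdZ v c p : dird v (c *: p) = c *: dird v p.
Proof. exact: linearZ. Qed.

Lemma dirdM v p q : dird v (p * q) = dird v p * q + p * dird v q.
Proof.
rewrite /dird mulr_suml mulr_sumr -big_split; apply: eq_bigr => i _ /=.
by rewrite mderivM scalerDr scalerAl scalerAr.
Qed.

Lemma dirdC v c : dird v c%:MP = 0.
Proof. by rewrite /dird big1 // => i _; rewrite mderivC scaler0. Qed.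

Lemma dirdX v i : dird v 'X_i = (v 0 i)%:MP.
Proof.
rewrite /dird (bigD1 i) //= big1 ?addr0 => [|j ji].
  have -> : 'X_i^`M(i) = 1 :> {mpoly R[n]}.
    rewrite mderivX mnm1E eqxx scale1r -mpolyX0; congr mpolyX.
    by apply/mnmP => k; rewrite mnmBE mnm0E subnn.
  by rewrite -mul_mpolyC mulr1.
by rewrite mderivX mnm1E eq_sym (negbTE ji) scale0r scaler0.
Qed.

Lemma dird_comm v w p : dird v (dird w p) = dird w (dird v p).
Proof.
rewrite {1}/dird [RHS]linear_sum; apply: eq_bigr => i _.
rewrite linearZ; congr (_ *: _); rewrite /dird (raddf_sum (mderiv i)); apply: eq_bigr => j _ /=.
by rewrite mderivZ mderiv_comm.
Qed.

Lemma dirdDl v w p : dird (v + w) p = dird v p + dird w p.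
Proof. by rewrite /dird -big_split; apply: eq_bigr => i _; rewrite mxE scalerDl. Qed.

Lemma dirdZl c v p : dird (c *: v) p = c *: dird v p.
Proof. by rewrite /dird scaler_sumr; apply: eq_bigr => i _; rewrite mxE scalerA. Qed.

Lemma meval_dird v p u : (dird v p).@[u 0] = \sum_i v 0 i * (p^`M(i)).@[u 0].
Proof. by rewrite meval_sum; apply: eq_bigr => i _; rewrite mevalZ. Qed.

Lemma meval_dird_grad v p u : (dird v p).@[u 0] = (v *m (grad p u)^T) 0 0.
Proof. by rewrite meval_dird mxE; apply: eq_bigr => i _; rewrite !mxE. Qed.

Lemma meval_dird2 v p u :
  (dird v (dird v p)).@[u 0] = (v *m hessian p u *m v^T) 0 0.
Proof.
rewrite meval_dird mxE; apply: eq_bigr => j _; rewrite !mxE mulrC; congr (_ * _).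
rewrite /dird (raddf_sum (mderiv j)) /= meval_sum; apply: eq_bigr => i _.
by rewrite mderivZ mevalZ mxE.
Qed.

Lemma meval_dird2M v p q u : (dird v (dird v (p * q))).@[u 0] =
  (dird v (dird v p)).@[u 0] * q.@[u 0]
  + 2%:R * ((dird v p).@[u 0] * (dird v q).@[u 0])
  + p.@[u 0] * (dird v (dird v q)).@[u 0].
Proof. by rewrite dirdM dirdD !dirdM !mevalD !mevalM; ring. Qed.

Definition nondegenerate_zero p u : Prop :=
  [/\ p.@[u 0] = 0, forall v, (dird v p).@[u 0] = 0
    & forall v, v != 0 -> 0 < (dird v (dird v p)).@[u 0]].

(* Hadamard's lemma is membership of [p - p(u)] in the maximal ideal of [u]. *)
Lemma hadamard p u : exists q : 'I_n -> {mpoly R[n]},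
  p = (p.@[u 0])%:MP + \sum_i q i * ('X_i - (u 0 i)%:MP).
Proof.
pose z i : {mpoly R[n]} := 'X_i - (u 0 i)%:MP.
suff [q Hq] : ideal_gen z (p - (p.@[u 0])%:MP).
  by exists q; rewrite -Hq addrC subrK.
have HM (a b : {mpoly R[n]}) : ideal_gen z (a - (a.@[u 0])%:MP) -> ideal_gen z (b - (b.@[u 0])%:MP) ->
    ideal_gen z (a * b - ((a * b).@[u 0])%:MP).
  move=> ha hb; rewrite mevalM rmorphM /=.
  rewrite (_ : _ - _ = a * (b - (b.@[u 0])%:MP) + (b.@[u 0])%:MP * (a - (a.@[u 0])%:MP)).
    by apply: idealD; exact: idealM.
  by ring.
have H0 (c : R) : ideal_gen z (c%:MP - (c%:MP_[n].@[u 0])%:MP).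
  by rewrite mevalC subrr; exact: ideal0.
elim/mpolyind: p => [|c m p _ _ IH]; first by rewrite -mpolyC0; exact: H0.
rewrite mevalD rmorphD opprD addrACA; apply: idealD => //.
rewrite -mul_mpolyC; apply: (HM); first exact: H0.
rewrite mpolyXE_id; apply: (big_ind (fun a : {mpoly R[n]} => ideal_gen z (a - (a.@[u 0])%:MP))) => //.
  by rewrite -mpolyC1; exact: H0.
move=> i _; elim: (m i) => [|k IHk]; first by rewrite expr0 -mpolyC1; exact: H0.
rewrite exprS; apply: HM => //; rewrite mevalXU; exact: (ideal_mem z i).
Qed.

(** Hadamard's lemma is applied to p and then to its coefficients, which vanish at u because the
    gradient does. The matrix A of polynomials need not be symmetric; the Hessian fixes only the
    symmetric part of its value at u. *)
Lemma hadamard2 p u : p.@[u 0] = 0 -> (forall v, (dird v p).@[u 0] = 0) ->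
  exists A : 'I_n -> 'I_n -> {mpoly R[n]},
    p = \sum_i \sum_j A i j * (('X_i - (u 0 i)%:MP) * ('X_j - (u 0 j)%:MP))
    /\ forall v, (dird v (dird v p)).@[u 0]
         = 2%:R * \sum_i \sum_j (A i j).@[u 0] * (v 0 i * v 0 j).
Proof.
move=> p0 dp0.
pose z i : {mpoly R[n]} := 'X_i - (u 0 i)%:MP.
have z0 i : (z i).@[u 0] = 0 by rewrite mevalB mevalXU mevalC subrr.
have dz v i : dird v (z i) = (v 0 i)%:MP by rewrite dirdB dirdX dirdC subr0.
have [q Hq] := hadamard p u; rewrite p0 mpolyC0 add0r in Hq.
have q0 i : (q i).@[u 0] = 0.
  have := dp0 (delta_mx 0 i); rewrite Hq dird_sum meval_sum (bigD1 i) //= big1.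
    by rewrite addr0 dirdM dz mevalD !mevalM z0 mevalC mulr0 add0r mxE !eqxx mulr1.
  move=> j ji; rewrite dirdM dz mevalD !mevalM z0 mevalC mulr0 add0r mxE.
  by rewrite eqxx (negbTE ji) mulr0.
have /choice[A HA] i := hadamard (q i) u.
have HqA i : q i = \sum_j A i j * z j by rewrite [LHS]HA q0 mpolyC0 add0r.
have pE : p = \sum_i \sum_j A i j * (z i * z j).
  rewrite Hq; apply: eq_bigr => i _; rewrite {1}HqA mulr_suml.
  by apply: eq_bigr => j _; rewrite /z; ring.
exists A; split=> // v; rewrite pE dird2_sum meval_sum mulr_sumr.
apply: eq_bigr => i _; rewrite dird2_sum meval_sum mulr_sumr.
apply: eq_bigr => j _ /=.
have e0 : (z i * z j).@[u 0] = 0 by rewrite mevalM z0 mul0r.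
have e1 : (dird v (z i * z j)).@[u 0] = 0.
  by rewrite dirdM mevalD !mevalM !z0 mulr0 mul0r addr0.
have e2 : (dird v (dird v (z i * z j))).@[u 0] = 2%:R * (v 0 i * v 0 j).
  by rewrite meval_dird2M !z0 !dz !mevalC mulr0 mul0r addr0 add0r.
by rewrite meval_dird2M e0 e1 e2; ring.
Qed.

End DirectionalDerivative.

(** * Diagonal certificates at nondegenerate zeros *)

Lemma cholesky (R : realType) (n : nat) (A : 'M[R]_n) : A^T = A ->
  (forall v : 'rV[R]_n, v != 0 -> 0 < (v *m A *m v^T) 0 0) ->
  exists L : 'M[R]_n, A = L *m L^T.
Proof.
elim: n A => [|n IH] A symA posA; first by exists 0; apply/matrixP => -[].
rewrite -[n.+1]/(1 + n)%N in A symA posA *.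
pose a := A 0 0; pose b := ursubmx A; pose C := drsubmx A.
have Ablock : A = block_mx a%:M b b^T C.
  rewrite -[LHS]submxK; congr block_mx.
    by apply/matrixP => i j; rewrite !ord1 !mxE eqxx mulr1n; congr (A _ _); exact/val_inj.
  by rewrite /b trmx_ursub symA.
have symC : C^T = C by rewrite /C trmx_drsub symA.
have a0 : 0 < a.
  have d0 : delta_mx 0 0 != 0 :> 'rV[R]_(1 + n).
    by apply/negP => /eqP/matrixP/(_ 0 0)/eqP; rewrite !mxE !eqxx oner_eq0.
  by have := posA _ d0; rewrite -rowE trmx_delta -colE !mxE.
have [L' HL'] : exists L' : 'M[R]_n, C - a^-1 *: (b^T *m b) = L' *m L'^T.
  apply: IH; first by rewrite linearB linearZ /= trmx_mul trmxK symC.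
  (* This x minimizes the form over the first coordinate, so the value at (x, w) is that of the
     Schur complement at w. *)
  move=> w w0; pose x := - (a^-1 *: (w *m b^T)); pose v : 'rV_(1 + n) := row_mx x w.
  have v0 : v != 0.
    apply: contraNneq w0 => v0; have := congr1 rsubmx v0.
    by rewrite row_mxKr linear0 => ->.
  have := posA v v0; congr (0 < _); congr (fun_of_matrix _ 0 0).
  rewrite Ablock mul_row_block tr_row_mx mul_row_col.
  rewrite mul_mx_scalar /x scalerN scalerA mulfV ?gt_eqF // scale1r addNr mul0mx add0r.
  by rewrite mulmxBr -scalemxAr mulmxA mulNmx -scalemxAl addrC.
have s0 : 0 < Num.sqrt a by rewrite sqrtr_gt0.
exists (block_mx (Num.sqrt a)%:M 0 ((Num.sqrt a)^-1 *: b^T) L').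
rewrite tr_block_mx mulmx_block !trmx0 !mul0mx !mulmx0 !addr0 tr_scalar_mx.
rewrite -scalar_mxM -expr2 sqr_sqrtr ?ltW //.
rewrite linearZ /= trmxK mul_scalar_mx scalerA mulfV ?gt_eqF // scale1r.
rewrite mul_mx_scalar scalerA mulfV ?gt_eqF // scale1r.
rewrite -HL'.
rewrite -scalemxAl -scalemxAr scalerA -invfM -expr2 sqr_sqrtr ?ltW //.
by rewrite addrC subrK.
Qed.

Section LocalCertificate.
Context (R : realType) (n : nat).
Implicit Types (p q : {mpoly R[n]}) (u v : 'rV[R]_n).

Definition unit_sphere : set 'rV[R]_n := [set y | \sum_i y 0 i ^+ 2 = 1].

Lemma meval_sqnorm u : (sqnorm R n).@[u 0] = \sum_i u 0 i ^+ 2.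
Proof. by rewrite meval_sum; apply: eq_bigr => i _; rewrite mevalXn mevalXU. Qed.

Lemma unit_sphere_compact : compact unit_sphere.
Proof.
apply: (subclosed_compact _ (@box_compact R n (-1) 1)); last first.
  move=> y y1 i; suff : y 0 i ^+ 2 <= 1 by move=> h; apply/andP; split; nra.
  rewrite -y1 (bigD1 i) //= lerDl; apply: sumr_ge0 => j _; exact: sqr_ge0.
have := @zero_locus_closed R n unit (fun=> sqnorm R n - 1).
congr closed; apply/seteqP; split => y /=.
  by move=> /(_ tt) /eqP; rewrite mevalB meval1 subr_eq0 meval_sqnorm => /eqP.
by move=> y1 _; rewrite mevalB meval1 meval_sqnorm y1 subrr.
Qed.

Lemma sum_sqr_gt0 v : v != 0 -> 0 < \sum_i v 0 i ^+ 2.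
Proof.
move=> v0; rewrite lt0r; apply/andP; split; last by apply: sumr_ge0 => i _; exact: sqr_ge0.
apply: contra v0; rewrite psumr_eq0 => [/allP H|i _]; last exact: sqr_ge0.
apply/eqP/rowP => i; rewrite mxE; apply/eqP.
by rewrite -sqrf_eq0; apply: H; rewrite mem_index_enum.
Qed.

Lemma normalize v : v != 0 -> exists2 c, 0 < c & unit_sphere (c *: v).
Proof.
move=> v0; have s0 := sum_sqr_gt0 v0.
exists (Num.sqrt (\sum_i v 0 i ^+ 2))^-1; first by rewrite invr_gt0 sqrtr_gt0.
rewrite /unit_sphere /=; under eq_bigr do rewrite mxE exprMn.
by rewrite -mulr_sumr exprVn sqr_sqrtr ?ltW // mulVf ?gt_eqF.
Qed.

Definition gradient_form p u : {mpoly R[n]} := \sum_i (p^`M(i)).@[u 0] *: 'X_i.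

Definition hessian_form p u : {mpoly R[n]} :=
  \sum_i \sum_j hessian p u i j *: ('X_i * 'X_j).

Lemma gradient_formE p u v : (gradient_form p u).@[v 0] = (dird v p).@[u 0].
Proof.
rewrite meval_dird meval_sum; apply: eq_bigr => i _.
by rewrite mevalZ mevalXU mulrC.
Qed.

Lemma hessian_formE p u v : (hessian_form p u).@[v 0] = (dird v (dird v p)).@[u 0].
Proof.
rewrite meval_dird2 mxE meval_sum.
under eq_bigr do rewrite meval_sum.
rewrite exchange_big; apply: eq_bigr => j _; rewrite !mxE mulr_suml.
by apply: eq_bigr => i _; rewrite mevalZ mevalM !mevalXU; ring.
Qed.

Lemma dird2Zl c v p u :
  (dird (c *: v) (dird (c *: v) p)).@[u 0] = c ^+ 2 * (dird v (dird v p)).@[u 0].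
Proof. by rewrite !dirdZl dirdZ !mevalZ mulrA expr2. Qed.

(** A penalty argument on the unit sphere: the differentials of the c_i act as equality constraints
    for the Hessian form, and inequalities are absent, hence the index type [void]. Homogeneity of
    degree 2 extends the bound to all v. *)
Lemma finsler (J : finType) (G : {mpoly R[n]}) (c : J -> {mpoly R[n]}) u :
  (forall v, v != 0 -> (forall i, (dird v (c i)).@[u 0] = 0) ->
     0 < (dird v (dird v G)).@[u 0]) ->
  exists2 C, 0 <= C & forall v, v != 0 ->
    0 < (dird v (dird v G)).@[u 0] + C * \sum_i (dird v (c i)).@[u 0] ^+ 2.
Proof.
move=> pos; pose h i := gradient_form (c i) u; pose g (j : void) : {mpoly R[n]} := 0.
have [_ _ []|v v1 [hv _]|m Hm] := @penalty_pos R n _ _ h g (hessian_form G u) _ unit_sphere_compact.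
  rewrite hessian_formE; apply: pos => [|i]; last by rewrite -gradient_formE; exact: hv.
  apply: contraPneq v1 => ->; rewrite /unit_sphere /= big1 => [|i _]; last by rewrite mxE expr0n.
  by move/eqP; rewrite eq_sym oner_eq0.
exists m%:R => // v /normalize[a a0 /Hm].
have S0 (F : void -> R) : \sum_j F j = 0 by rewrite big1 // => -[].
rewrite mevalD meval_penalty hessian_formE dird2Zl S0 subr0.
under eq_bigr do rewrite gradient_formE dirdZl mevalZ exprMn.
rewrite -mulr_sumr mulrCA -mulrDr pmulr_rgt0 //; exact: exprn_gt0.
Qed.

Lemma nondegenerate_zero_coercive p u : nondegenerate_zero p u ->
  exists2 e, 0 < e & forall v, e * \sum_i v 0 i ^+ 2 <= (dird v (dird v p)).@[u 0].
Proof.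
move=> [_ _ pos].
have [v v1|e e0 He] := compact_min (p := hessian_form p u) unit_sphere_compact.
  rewrite hessian_formE; apply: pos.
  apply: contraPneq v1 => ->; rewrite /unit_sphere /= big1 => [|i _]; last by rewrite mxE expr0n.
  by move/eqP; rewrite eq_sym oner_eq0.
exists e => // v; have [->|v0] := eqVneq v 0.
  rewrite big1 => [|i _]; last by rewrite mxE expr0n.
  by have := dird2Zl 0 0 p u; rewrite scale0r expr0n mul0r => ->; rewrite mulr0.
have [a a0 av] := normalize v0; have := He _ av.
rewrite hessian_formE dird2Zl => H.
have a1 : a ^+ 2 * \sum_i v 0 i ^+ 2 = 1.
  by rewrite -av mulr_sumr; apply: eq_bigr => i _; rewrite mxE exprMn.
rewrite -(ler_pM2l (exprn_gt0 2 a0)) mulrCA a1 mulr1; exact: H.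
Qed.

(** Write G = \sum A_ij z_i z_j with z = X - u. The constant matrix A(u) is positive definite:
    Cholesky turns it, less some slack, into squares. The differences A_ij - A_ij(u) are small near
    u; completing squares charges their cross terms to the slack, which becomes the diagonal
    coefficients c_j. *)
Lemma nondegenerate_zero_sos G u : nondegenerate_zero G u ->
  exists s (c : 'I_n -> {mpoly R[n]}), [/\ sos s, forall j, 0 < (c j).@[u 0]
    & G = s + \sum_j ('X_j - (u 0 j)%:MP) ^+ 2 * c j].
Proof.
move=> ndG; have [G0 dG0 _] := ndG.
have [e e0 He] := nondegenerate_zero_coercive ndG.
have [A [GA D2A]] := hadamard2 G0 dG0.
pose z i : {mpoly R[n]} := 'X_i - (u 0 i)%:MP.
pose S := \matrix_(i, j) (((A i j).@[u 0] + (A j i).@[u 0]) / 2%:R).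
have Sform (x : 'I_n -> {mpoly R[n]}) :
    \sum_i \sum_j S i j *: (x i * x j) = \sum_i \sum_j (A i j).@[u 0] *: (x i * x j).
  apply: (scalerI (a := 2%:R)); first by rewrite pnatr_eq0.
  rewrite !scaler_sumr [in RHS](eq_bigr _ (fun i _ => scaler_sumr _ _ _ _)).
  transitivity (\sum_i \sum_j (A i j).@[u 0] *: (x i * x j)
                + \sum_i \sum_j (A j i).@[u 0] *: (x i * x j)).
    rewrite -big_split; apply: eq_bigr => i _; rewrite scaler_sumr -big_split.
    apply: eq_bigr => j _ /=; rewrite mxE scalerA mulrC divfK ?pnatr_eq0 //.
    by rewrite scalerDl.
  rewrite [X in _ + X]exchange_big -big_split; apply: eq_bigr => i _.
  rewrite -big_split; apply: eq_bigr => j _ /=.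
  by rewrite [x j * x i]mulrC scaler_nat mulr2n.
(* By [He] and [D2A] the form of S is at least (e / 2) |v|^2, so S minus e / 4 is still positive
   definite, and e / 4 is the slack kept for the c_j. *)
have [L HL] : exists L : 'M[R]_n, S - (e / 4%:R)%:M = L *m L^T.
  apply: cholesky.
    rewrite linearB /= tr_scalar_mx; congr (_ - _).
    by apply/matrixP => i j; rewrite !mxE addrC.
  move=> v v0; have := sum_sqr_gt0 v0; have := He v; rewrite D2A.
  have /(congr1 (meval (v 0))) := Sform (fun i => 'X_i).
  rewrite !meval_sum; under eq_bigr do rewrite meval_sum.
  under [in RHS]eq_bigr do rewrite meval_sum.
  under eq_bigr do under eq_bigr do rewrite mevalZ mevalM !mevalXU.
  under [in RHS]eq_bigr do under eq_bigr do rewrite mevalZ mevalM !mevalXU.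
  move=> <-; rewrite mulmxBr mulmxBl mul_mx_scalar -scalemxAl.
  have -> : (v *m S *m v^T - (e / 4%:R) *: (v *m v^T)) 0 0
      = \sum_i \sum_j S i j * (v 0 i * v 0 j) - e / 4%:R * \sum_i v 0 i ^+ 2.
    rewrite !mxE; congr (_ - _ * _); last by apply: eq_bigr => i _; rewrite mxE expr2.
    rewrite exchange_big; apply: eq_bigr => j _; rewrite !mxE mulr_suml.
    by apply: eq_bigr => i _; ring.
  nra.
have [N N0 nN] : exists2 N : R, 0 < N & n%:R <= N.
  by exists n.+1%:R; rewrite ?ltr0n // ler_nat.
have Nn : N != 0 by rewrite gt_eqF.
have en : e != 0 by rewrite gt_eqF.
(* Completing the squares costs (k / 2) z_i^2 for each of n indices j, in total at most (e / 16)
   z_i^2, less than the slack e / 4. *)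
pose k := (e / (8%:R * N))%:MP_[n].
pose k' := ((8%:R * N) / e)%:MP_[n].
have kk' : k * k' = 1.
  by rewrite /k /k' -mpolyCM -mpolyC1; congr mpolyC; field; rewrite Nn en.
pose h := (2%:R^-1 : R)%:MP_[n].
have h2 : h * 2%:R = 1.
  by rewrite /h mulr_natr -mpolyCMn -mpolyC1; congr mpolyC; field.
pose T i j := A i j - ((A i j).@[u 0])%:MP.
pose c j := (e / 4%:R)%:MP_[n] - \sum_(i < n) h * k - \sum_i h * k' * T i j ^+ 2.
exists (\sum_k (\sum_i (L i k)%:MP * z i) ^+ 2
        + \sum_i \sum_j h * k * (z i + k' * T i j * z j) ^+ 2).
exists c; split.
- apply: sosD; apply: sos_sum => i _; first exact: sos_sq.
  apply: sos_sum => j _; apply: sosM; last exact: sos_sq.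
  apply: sosM; apply: sosC; first by rewrite invr_ge0 ler0n.
  by rewrite divr_ge0 ?ltW // mulr_gt0.
- move=> j; rewrite !mevalB mevalC !meval_sum [X in _ - X]big1 => [|i _]; last first.
    by rewrite mevalM mevalXn mevalB mevalC subrr expr0n mulr0.
  under eq_bigr do rewrite mevalM !mevalC.
  rewrite sumr_const card_ord subr0 subr_gt0 -[ltLHS]mulr_natl.
  have eN : 0 < e / N by rewrite divr_gt0.
  have -> : n%:R * (2^-1 * (e / (8 * N))) = n%:R * (e / N) / 16%:R.
    by field.
  have : n%:R * (e / N) <= N * (e / N) by rewrite ler_pM2r.
  rewrite [N * _]mulrC divfK ?gt_eqF //; lra.
have E1 : \sum_k (\sum_i (L i k)%:MP * z i) ^+ 2
    = \sum_i \sum_j (L *m L^T) i j *: (z i * z j).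
  under eq_bigr do rewrite expr2 big_distrlr /=.
  rewrite exchange_big; apply: eq_bigr => i _; rewrite exchange_big.
  apply: eq_bigr => j _; rewrite mxE scaler_suml; apply: eq_bigr => l _.
  by rewrite mxE -mul_mpolyC mpolyCM; ring.
have E2 : \sum_i \sum_j (A i j).@[u 0] *: (z i * z j)
    = \sum_j (e / 4%:R)%:MP * z j ^+ 2 + \sum_k (\sum_i (L i k)%:MP * z i) ^+ 2.
  rewrite -Sform E1 -HL -big_split; apply: eq_bigr => i _ /=.
  under [in RHS]eq_bigr do rewrite mxE scalerDl.
  rewrite big_split /= addrCA -[LHS]addr0; congr (_ + _).
  rewrite (bigD1 i) //= !mxE eqxx mulr1n big1 => [|j ji].
    by rewrite addr0 scaleNr -mul_mpolyC expr2 subrr.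
  by rewrite !mxE eq_sym (negbTE ji) mulr0n oppr0 scale0r.
(* [T i j] vanishes at [u], so its cross terms are absorbed by the slack [e]. *)
have E3 i j : T i j * (z i * z j) = h * k * (z i + k' * T i j * z j) ^+ 2
    - h * k * z i ^+ 2 - h * k' * T i j ^+ 2 * z j ^+ 2.
  transitivity ((h * 2%:R) * (k * k') * (T i j * (z i * z j))
     + h * k' * T i j ^+ 2 * z j ^+ 2 * (k * k' - 1)).
    by rewrite h2 kk' subrr mulr0 addr0 !mul1r.
  by ring.
have E4 : \sum_j z j ^+ 2 * c j = \sum_j (e / 4%:R)%:MP * z j ^+ 2
    - \sum_i \sum_(j < n) h * k * z i ^+ 2
    - \sum_i \sum_j h * k' * T i j ^+ 2 * z j ^+ 2.
  rewrite [X in _ - X]exchange_big -!sumrB; apply: eq_bigr => j _ /=.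
  rewrite /c !mulrBr !mulr_sumr; congr (_ - _ - _); first by rewrite mulrC.
    by apply: eq_bigr => i _; rewrite mulrC.
  by apply: eq_bigr => i _; rewrite mulrC.
rewrite E4 {1}GA.
have -> : \sum_i \sum_j A i j * (z i * z j) = \sum_i \sum_j (A i j).@[u 0] *: (z i * z j)
   + \sum_i \sum_j T i j * (z i * z j).
  rewrite -big_split; apply: eq_bigr => i _; rewrite -big_split; apply: eq_bigr => j _ /=.
  by rewrite /T -mul_mpolyC; ring.
rewrite E2.
under [X in _ + X = _]eq_bigr do under eq_bigr do rewrite E3.
under [X in _ + X = _]eq_bigr do rewrite !sumrB.
rewrite !sumrB; ring.
Qed.

End LocalCertificate.

Arguments unit_sphere {R n}.

(** * From optimality conditions to local certificates *)

Section OptimalityCertificate.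
Context (R : realType) (n : nat).
Implicit Types (p q : {mpoly R[n]}) (u v : 'rV[R]_n).

Definition local_certificate (E I : finType) (h : E -> {mpoly R[n]})
    (g : I -> {mpoly R[n]}) (F : {mpoly R[n]}) u : Prop :=
  exists2 tau, qmodule h g tau & nondegenerate_zero (F - tau) u.

Lemma nondegenerate_zeroD p q u :
  p.@[u 0] = 0 -> (forall v, (dird v p).@[u 0] = 0) ->
  q.@[u 0] = 0 -> (forall v, (dird v q).@[u 0] = 0) ->
  (forall v, v != 0 -> 0 < (dird v (dird v p)).@[u 0] + (dird v (dird v q)).@[u 0]) ->
  nondegenerate_zero (p + q) u.
Proof.
move=> p0 dp0 q0 dq0 pos; split.
- by rewrite mevalD p0 q0 addr0.
- by move=> v; rewrite dirdD mevalD dp0 dq0 addr0.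
- by move=> v v0; rewrite !dirdD mevalD; exact: pos.
Qed.

(** The term with three factors l has vanishing derivatives up to order two at u, and the factor w
    only rescales the Hessian, since p vanishes to second order. *)
Lemma nondegenerate_zeroM p (w l r : {mpoly R[n]}) u : nondegenerate_zero p u ->
  0 < w.@[u 0] -> l.@[u 0] = 0 -> nondegenerate_zero (w * p + l * (l * (l * r))) u.
Proof.
move=> [p0 dp0 pos] w0 l0; apply: nondegenerate_zeroD.
- by rewrite mevalM p0 mulr0.
- by move=> v; rewrite dirdM mevalD !mevalM p0 dp0 !mulr0 addr0.
- by rewrite mevalM l0 mul0r.
- by move=> v; rewrite dirdM mevalD !mevalM l0 !mul0r mulr0 addr0.
- move=> v v0; rewrite !meval_dird2M p0 dp0 l0.
  have -> : (l * (l * r)).@[u 0] = 0 by rewrite mevalM l0 mul0r.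
  have -> : (dird v (l * (l * r))).@[u 0] = 0.
    by rewrite dirdM mevalD !mevalM l0 !(mul0r, mulr0, addr0).
  by rewrite !(mul0r, mulr0, addr0, add0r) mulr_gt0 // pos.
Qed.

(** The Hessian of the Lagrangian is positive only on the tangent space; Finsler's lemma extends
    this to all directions after adding C \sum c_i^2. The subtracted squares are harmless for
    equalities, being in the ideal, and for active inequalities strict complementarity gives a
    positive multiplier to hide them in. *)
Lemma optimality_local_certificate (E I : finType) (Q : problem R n E I) u
    (lam : E + I -> R) :
  feasible Q u -> (obj Q).@[u 0] = 0 ->
  lagrange_multiplier Q u lam -> SCC Q u lam -> SOSC Q u lam ->
  local_certificate (eqc Q) (ineqc Q) (obj Q) u.
Proof.
move=> [hu gu] F0 [stat lam0 compl] scc sosc.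
pose act := active Q u.
(* Inactive constraints are replaced by 0: complementarity kills their multipliers, and now every
   c_i vanishes at u. *)
pose c i := if i \in act then constr Q i else 0.
have c0 i : (c i).@[u 0] = 0.
  by rewrite /c; case: ifP => [|_]; rewrite ?meval0 // inE => /eqP.
have lamc i : lam i *: constr Q i = lam i *: c i.
  rewrite /c; case: ifP => // /negbT; rewrite inE; case: i => [e|j] /= ne.
    by rewrite hu eqxx in ne.
  have /eqP := compl j; rewrite mulf_eq0 (negbTE ne) orbF => /eqP ->.
  by rewrite !scale0r.
pose G := lagrangian Q lam.
have G0 : G.@[u 0] = 0.
  rewrite mevalB F0 sub0r meval_sum big1 ?oppr0 // => i _.
  by rewrite lamc mevalZ c0 mulr0.
have dG0 v : (dird v G).@[u 0] = 0.
  rewrite dirdB mevalB meval_dird_grad stat dird_sum meval_sum.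
  rewrite (raddf_sum trmx) mulmx_sumr summxE /= -sumrB big1 // => i _.
  by rewrite dirdZ mevalZ meval_dird_grad linearZ /= -scalemxAr mxE subrr.
have [v v0 dc|C C0 HC] := @finsler R n _ G c u.
  rewrite meval_dird2; apply: sosc => // i iact; apply/matrixP => a b.
  by rewrite !ord1 -meval_dird_grad mxE; have := dc i; rewrite /c iact.
pose mu j := C / (2%:R * lam (inr j)).
pose tau := \sum_e (lam (inl e) *: eqc Q e - C *: eqc Q e ^+ 2)
  + \sum_(j | inr j \in act) ineqc Q j * (lam (inr j) *: (1 - mu j *: ineqc Q j) ^+ 2).
(* [l c - C c^2 = c l (1 - C c / (2 l))^2 - C^2 c^3 / (4 l)]: the negative
   square needed by Finsler's lemma costs only a term of order three. *)
exists tau.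
  apply: qmoduleD; last first.
    apply: qmodule_sum => j _; apply: qmodule_ineq; apply: sosZ => //; exact: sos_sq.
  apply: qmodule_ideal; apply: ideal_sum => e _; apply: idealB; apply: idealZ.
    exact: ideal_mem.
  by rewrite expr2; apply: idealM; exact: ideal_mem.
pose b (i : E + I) : R := match i with inl _ => 0 | inr j => C ^+ 2 / (4%:R * lam i) end.
pose t i := C *: (c i * c i) - b i *: (c i * (c i * c i)).
have -> : obj Q - tau = G + \sum_i t i.
  suff : tau = \sum_i (lam i *: c i - t i).
    by move=> ->; rewrite sumrB /G /lagrangian (eq_bigr _ (fun i _ => lamc i)); ring.
  rewrite big_sumType /=; congr (_ + _).
    apply: eq_bigr => e _.
    have ce : c (inl e) = eqc Q e by rewrite /c inE /= hu eqxx.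
    by rewrite /t ce /b scale0r subr0 expr2.
  rewrite big_mkcond; apply: eq_bigr => j _.
  rewrite /t /c; case: ifP => [jact|_]; last by rewrite !(mul0r, scaler0, subr0).
  have lj : 0 < lam (inr j).
    by have := scc j; move: jact; rewrite inE => /eqP /= ->; rewrite addr0.
  rewrite /= /mu; set p := ineqc Q j; set l := lam (inr j) in lj *.
  rewrite -!mul_mpolyC.
  have e1 : l%:MP_[n] * (C / (2%:R * l))%:MP * 2%:R = C%:MP.
    rewrite -mpolyCM mulr_natr -mpolyCMn -mulr_natr; congr mpolyC; field; rewrite gt_eqF //.
  have e2 : l%:MP_[n] * (C / (2%:R * l))%:MP * (C / (2%:R * l))%:MP = (C ^+ 2 / (4%:R * l))%:MP.
    by rewrite -!mpolyCM; congr mpolyC; field; rewrite gt_eqF.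
  by rewrite -e1 -e2; ring.
apply: nondegenerate_zeroD => //.
- by rewrite meval_sum big1 // => i _; rewrite mevalB !mevalZ !mevalM c0 !mul0r !mulr0 subrr.
- move=> v; rewrite dird_sum meval_sum big1 // => i _.
  by rewrite dirdB !dirdZ !dirdM mevalB !mevalZ !mevalD !mevalM c0 !(mulr0, mul0r, addr0) subrr.
move=> v v0; rewrite dird2_sum [X in _ + X]meval_sum.
apply: lt_le_trans (HC v v0) _; rewrite lerD2l mulr_sumr; apply: ler_sum => i _.
rewrite !dirdB !dirdZ mevalB !mevalZ !meval_dird2M !mevalM c0.
have -> : (dird v (c i * c i)).@[u 0] = 0 by rewrite dirdM mevalD !mevalM c0 mulr0 mul0r addr0.
rewrite !(mul0r, mulr0, addr0, add0r) subr0.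
by rewrite ler_wpM2l // -expr2 mulr_natl mulr2n lerDl sqr_ge0.
Qed.

Lemma local_certificate_diag (E I : finType) (h : E -> {mpoly R[n]})
    (g : I -> {mpoly R[n]}) F u : local_certificate h g F u ->
  exists tau (c : 'I_n -> {mpoly R[n]}), [/\ qmodule h g tau,
    forall j, 0 < (c j).@[u 0]
    & F = tau + \sum_j ('X_j - (u 0 j)%:MP) ^+ 2 * c j].
Proof.
move=> [tau Mtau /nondegenerate_zero_sos[s [c [ss c0 FE]]]].
exists (tau + s), c; split=> //.
  by apply: qmoduleD => //; exact: qmodule_sos.
by rewrite -addrA -FE addrC subrK.
Qed.

End OptimalityCertificate.

(** * From local to global certificates *)

Section LocalGlobal.
Context (R : realType) (n : nat) (E I : finType).
Context (h : E -> {mpoly R[n]}) (g : I -> {mpoly R[n]}).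
Context (hsph : ideal_gen h (sqnorm R n - 1)).
Let S := semialg_set h g.
Implicit Types (u x y : 'rV[R]_n).

Lemma semialg_set_sphere y : S y -> unit_sphere y.
Proof.
move=> [hy _]; have := ideal_vanish hsph hy.
by rewrite mevalB meval1 meval_sqnorm => /eqP; rewrite subr_eq0 => /eqP.
Qed.

Lemma semialg_set_compact : compact S.
Proof.
have -> : S = unit_sphere `&` ([set y | forall i, (h i).@[y 0] = 0]
    `&` [set y | forall j, 0 <= (g j).@[y 0]]).
  apply/seteqP; split => y; last by move=> [].
  by move=> Sy; split; first exact: semialg_set_sphere.
apply: compact_closedI; first exact: unit_sphere_compact.
by apply: closedI; [exact: zero_locus_closed | exact: nonneg_locus_closed].
Qed.

(** This lets a quadratic module containing the sphere relation absorb multiplication by any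
    polynomial positive on the sphere, in particular by w / 2. *)
Lemma sphere_pos_sos_mod p :
  (forall y : 'rV[R]_n, unit_sphere y -> 0 < p.@[y 0]) -> sos_mod h p.
Proof.
move=> pos.
pose h0 (_ : unit) := sqnorm R n - 1; pose g0 (_ : void) : {mpoly R[n]} := 0.
have [_ _ []|y _ [hy _]|m Hm] := @penalty_pos R n _ _ h0 g0 p _ (@box_compact R n (-1) 1).
  apply: pos; apply/eqP; rewrite -subr_eq0; have /eqP := hy tt.
  by rewrite mevalB meval1 meval_sqnorm.
rewrite -[p](addrK (penalty h0 g0 m)) addrC; apply: sos_mod_ideal; last first.
  exact: box_pos_sos_mod.
apply: idealN; rewrite /penalty [X in _ - _ *: X]big1 => [|[]//].
rewrite scaler0 subr0; apply: idealZ; apply: ideal_sum => i _.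
by rewrite expr2; exact: idealM.
Qed.

Definition sqdist (u y : 'rV[R]_n) : R := \sum_i (y 0 i - u 0 i) ^+ 2.

Lemma sqdist_gt0 u y : y != u -> 0 < sqdist u y.
Proof.
rewrite -subr_eq0 => /sum_sqr_gt0; congr (_ < _).
by apply: eq_bigr => i _; rewrite !mxE.
Qed.

Definition gap (u : 'rV[R]_n) : {mpoly R[n]} := 1 - \sum_i u 0 i *: 'X_i.

Lemma meval_gap u y : (gap u).@[y 0] = 1 - \sum_i u 0 i * y 0 i.
Proof.
rewrite mevalB meval1 meval_sum; congr (_ - _).
by apply: eq_bigr => i _; rewrite mevalZ mevalXU.
Qed.

Lemma sqdist_gap_mod u : unit_sphere u ->
  \sum_i ('X_i - (u 0 i)%:MP) ^+ 2 = (sqnorm R n - 1) + 2%:R *: gap u.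
Proof.
move=> u1; rewrite /sqnorm /gap.
have -> : \sum_i ('X_i - (u 0 i)%:MP) ^+ 2
    = \sum_i 'X_i ^+ 2 - 2%:R *: (\sum_i u 0 i *: 'X_i) + (\sum_i u 0 i ^+ 2)%:MP
      :> {mpoly R[n]}.
  rewrite (raddf_sum (@mpolyC n R)) scaler_sumr -sumrB -big_split; apply: eq_bigr => i _ /=.
  by rewrite scaler_nat -mul_mpolyC rmorphXn /=; ring.
by rewrite u1 mpolyC1 scalerBr !scaler_nat; ring.
Qed.

Lemma sqdist_gap u y : unit_sphere u -> unit_sphere y ->
  sqdist u y = 2%:R * (gap u).@[y 0].
Proof.
move=> u1 y1; have /(congr1 (meval (y 0))) := sqdist_gap_mod u1.
rewrite meval_sum mevalD mevalB meval_sqnorm y1 meval1 subrr add0r mevalZ => <-.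
by apply: eq_bigr => i _; rewrite mevalXn mevalB mevalXU mevalC.
Qed.

Lemma gap_ge0 u y : unit_sphere u -> unit_sphere y -> 0 <= (gap u).@[y 0].
Proof.
move=> u1 y1; have := sqdist_gap u1 y1.
have : 0 <= sqdist u y by apply: sumr_ge0 => i _; exact: sqr_ge0.
lra.
Qed.

Lemma gap_gt0 u y : unit_sphere u -> unit_sphere y -> y != u -> 0 < (gap u).@[y 0].
Proof. by move=> u1 y1 /sqdist_gt0; rewrite sqdist_gap //; lra. Qed.

Lemma gap_le2 u y : unit_sphere u -> unit_sphere y -> (gap u).@[y 0] <= 2%:R.
Proof.
move=> u1 y1; have Nu1 : unit_sphere (- u).
  by rewrite /unit_sphere /= -u1; apply: eq_bigr => i _; rewrite mxE sqrrN.
have := gap_ge0 Nu1 y1; rewrite !meval_gap.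
under eq_bigr do rewrite mxE mulNr.
by rewrite sumrN; lra.
Qed.

Lemma gap_self u : unit_sphere u -> (gap u).@[u 0] = 0.
Proof.
move=> u1; rewrite meval_gap -u1; under [in X in _ - X]eq_bigr do rewrite -expr2.
by rewrite subrr.
Qed.

(** Cauchy-Schwarz with |u| = 1: the defect is the squared norm of the component of y - x orthogonal
    to u. *)
Lemma sqr_gapB u x y : unit_sphere u ->
  ((gap u).@[x 0] - (gap u).@[y 0]) ^+ 2 <= sqdist x y.
Proof.
move=> u1; rewrite !meval_gap.
set s := (1 - _ - (1 - _)); have sE : s = \sum_i u 0 i * (y 0 i - x 0 i).
  transitivity (\sum_i u 0 i * y 0 i - \sum_i u 0 i * x 0 i); first by rewrite /s; ring.
  by rewrite -sumrB; apply: eq_bigr => i _; rewrite mulrBr.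
rewrite -subr_ge0.
have -> : sqdist x y - s ^+ 2 = \sum_i ((y 0 i - x 0 i) - s * u 0 i) ^+ 2.
  rewrite (eq_bigr (fun i => (y 0 i - x 0 i) ^+ 2
    - (2%:R * s) * (u 0 i * (y 0 i - x 0 i)) + s ^+ 2 * u 0 i ^+ 2)) => [|i _]; last by ring.
  by rewrite big_split sumrB /= -!mulr_sumr -sE u1 /sqdist; ring.
by apply: sumr_ge0 => i _; exact: sqr_ge0.
Qed.

(** On the sphere this is (1 + <u, X>) / 2, which equals 1 only at u, so its powers concentrate
    there. *)
Definition taper u : {mpoly R[n]} := 1 - 2%:R^-1 *: gap u.

Lemma meval_taper u y : (taper u).@[y 0] = 1 - (gap u).@[y 0] / 2%:R.
Proof. by rewrite mevalB meval1 mevalZ mulrC. Qed.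

Lemma taper01 u y : unit_sphere u -> unit_sphere y -> 0 <= (taper u).@[y 0] <= 1.
Proof.
move=> u1 y1; have := gap_ge0 u1 y1; have := gap_le2 u1 y1; rewrite meval_taper.
by move=> *; apply/andP; split; lra.
Qed.

(* The sign condition keeps [(1 - q) / gap u] nonnegative at [u], where [gap u]
   vanishes. *)
Definition unit_mod_gap u (q : {mpoly R[n]}) : Prop :=
  exists w, q = 1 - gap u * w /\ 0 <= w.@[u 0].

Lemma unit_mod_gap1 u : unit_mod_gap u 1.
Proof. by exists 0; rewrite mulr0 subr0 meval0. Qed.

Lemma unit_mod_gapM u p q : unit_sphere u ->
  unit_mod_gap u p -> unit_mod_gap u q -> unit_mod_gap u (p * q).
Proof.
move=> u1 [a [-> a0]] [b [-> b0]]; exists (a + b - gap u * (a * b)).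
split; first by ring.
by rewrite mevalB mevalD mevalM gap_self // mul0r subr0 addr_ge0.
Qed.

Lemma unit_mod_gapX u p k : unit_sphere u -> unit_mod_gap u p -> unit_mod_gap u (p ^+ k).
Proof.
move=> u1 up; elim: k => [|k IH]; first by rewrite expr0; exact: unit_mod_gap1.
by rewrite exprS; exact: unit_mod_gapM.
Qed.

Lemma unit_mod_gap_scale u c : 0 <= c -> unit_mod_gap u (1 - c *: gap u).
Proof.
move=> c0; exists c%:MP; split; last by rewrite mevalC.
by rewrite mulrC mul_mpolyC.
Qed.

Lemma mul_conj_itv01 (s : R) : 0 <= s -> s <= 2%:R ->
  0 <= (1 + s / 2%:R) * (1 - s / 2%:R) <= 1.
Proof.
move=> s0 s2; apply/andP; split; first by apply: mulr_ge0; lra.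
by have := sqr_ge0 (s / 2%:R); lra.
Qed.

(** For each x in Z the affine factor 1 - gap u / (gap u)(x) is 1 at u and 0 at x, but may exceed 1
    in modulus when x is close to u. A power of [taper u] compensates without changing the value at
    u. *)
Lemma separating_multiplier u (Z : seq 'rV[R]_n) : unit_sphere u -> u \notin Z ->
  (forall x, x \in Z -> unit_sphere x) ->
  exists X, [/\ unit_mod_gap u X, forall y, unit_sphere y -> `|X.@[y 0]| <= 1
    & forall x, x \in Z -> exists2 Y, forall y, unit_sphere y -> `|Y.@[y 0]| <= 1
        & X = (1 - ((gap u).@[x 0])^-1 *: gap u) * Y].
Proof.
move=> u1; elim: Z => [|x Z IH].
  by exists 1; split=> // [|y _]; [exact: unit_mod_gap1 | rewrite meval1 normr1].
rewrite inE negb_or => /andP[ux uZ] Z1.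
have [|X [uX X1 HX]] := IH uZ; first by move=> y yZ; apply: Z1; rewrite inE yZ orbT.
have x1 : unit_sphere x by apply: Z1; rewrite mem_head.
have tx : 0 < (gap u).@[x 0] by apply: gap_gt0 => //; rewrite eq_sym.
set t := (gap u).@[x 0] in tx *.
(* With 1 / t <= p / 2 one gets |1 - s / t| <= 1 + p s / 2 <= (1 + s / 2)^p, and the product with (1
   - s / 2)^p is at most 1. *)
pose p := Num.bound (2%:R / t).
have pt : t^-1 <= p%:R / 2%:R.
  rewrite ler_pdivlMr // mulrC; apply/ltW/archi_boundP; rewrite divr_ge0 //; exact: ltW.
pose phi := (1 - t^-1 *: gap u) * taper u ^+ p.
have taper1 k y : unit_sphere y -> `|(taper u ^+ k).@[y 0]| <= 1.
  move=> y1; have /andP[b0 b1] := taper01 u1 y1.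
  by rewrite mevalXn ger0_norm ?exprn_ge0 // exprn_ile1.
have phi1 y : unit_sphere y -> `|phi.@[y 0]| <= 1.
  move=> y1; rewrite mevalM mevalXn mevalB meval1 mevalZ normrM.
  have /andP[b0 b1] := taper01 u1 y1; have s0 := gap_ge0 u1 y1; have s2 := gap_le2 u1 y1.
  set s := (gap u).@[y 0] in s0 s2 *.
  have hs : 0 <= s / 2%:R by lra.
  have := bernoulli_ineq p hs => bern.
  have ts : 0 <= t^-1 * s by rewrite mulr_ge0 // invr_ge0 ltW.
  have e1 : `|1 - t^-1 * s| <= (1 + s / 2%:R) ^+ p.
    apply: le_trans bern.
    have : t^-1 * s <= p%:R * (s / 2%:R) by rewrite mulrA mulrAC ler_wpM2r.
    by rewrite ler_norml => *; apply/andP; split; lra.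
  rewrite (ger0_norm (exprn_ge0 _ b0)).
  apply: le_trans (ler_wpM2r (exprn_ge0 _ b0) e1) _.
  rewrite -exprMn meval_taper -/s.
  by have /andP[q0 q1] := mul_conj_itv01 s0 s2; exact: exprn_ile1.
exists (phi * X); split.
- apply: unit_mod_gapM => //; apply: unit_mod_gapM => //.
    by apply: unit_mod_gap_scale; rewrite invr_ge0 ltW.
  apply: unit_mod_gapX => //; apply: unit_mod_gap_scale; by rewrite invr_ge0.
- by move=> y y1; rewrite mevalM normrM mulr_ile1 ?phi1 ?X1.
move=> z; rewrite inE => /predU1P[->|/HX[Y Y1 XY]].
  exists (taper u ^+ p * X); last by rewrite /phi -/t mulrA.
  by move=> y y1; rewrite mevalM normrM mulr_ile1 ?taper1 ?X1.
exists (phi * Y); last by rewrite XY mulrCA.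
by move=> y y1; rewrite mevalM normrM mulr_ile1 ?phi1 ?Y1.
Qed.

Lemma geometric_decay (x C a : R) : 0 < x -> x <= 1 -> 0 < a ->
  exists k0, forall k, (k0 <= k)%N -> C * (1 - x) ^+ (k + k) < a.
Proof.
move=> x0 x1 a0; exists (Num.bound (`|C| / (x * a))).+1 => k kk.
have k0 : (0 < k)%N by exact: leq_ltn_trans kk.
have kR : 0 < k%:R :> R by rewrite ltr0n.
have r0 : 0 <= (1 - x) ^+ (k + k) by rewrite exprn_ge0 // subr_ge0.
apply: (@le_lt_trans _ _ (`|C| * (1 - x) ^+ (k + k))).
  by rewrite ler_wpM2r // ler_norm.
have H : (1 - x) ^+ (k + k) <= (x * k%:R)^-1.
  by rewrite invfM -(ler_pM2l x0) mulrA mulfV ?gt_eqF // mul1r mul_geom_le.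
apply: le_lt_trans (ler_wpM2l (normr_ge0 C) H) _.
have xa : 0 < x * a by exact: mulr_gt0.
have := archi_boundP (divr_ge0 (normr_ge0 C) (ltW xa)); set b := Num.bound _ => hb.
rewrite ltr_pdivrMr ?mulr_gt0 //; rewrite ltr_pdivrMr // in hb.
have bk : b%:R <= k%:R :> R by rewrite ler_nat ltnW.
have : 0 <= x * a * (k%:R - b%:R) by rewrite mulr_ge0 ?subr_ge0 // ltW.
lra.
Qed.

End LocalGlobal.

(** * Induction on the zeros of the objective *)

Section LocalGlobalPrinciple.
Context (R : realType) (n : nat) (E I : finType).
Context (h : E -> {mpoly R[n]}) (g : I -> {mpoly R[n]}).
Context (hsph : ideal_gen h (sqnorm R n - 1)).
Let S := semialg_set h g.
Let M := qmodule h g.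
Implicit Types (u x y : 'rV[R]_n).

(** On S the module part of the local certificate is nonnegative, so F dominates its diagonal part.
    This isolates the zeros of F and gives the rate against which damped coefficients are
    compared. *)
Lemma local_certificate_growth F u : local_certificate h g F u ->
  exists2 e, 0 < e & nbhs u [set y : 'rV[R]_n | S y -> e * sqdist u y <= F.@[y 0]].
Proof.
move=> /local_certificate_diag[tau [c [Mtau c0 FE]]].
have /choice[d Hd] : forall j, exists d, 0 < d /\ d < (c j).@[u 0].
  by move=> j; exists ((c j).@[u 0] / 2); have := c0 j; split; lra.
have [e e0 ed] : exists2 e, 0 < e & forall j, e <= d j.
  exists (\big[Num.min/1]_j d j); last by move=> j; exact: bigmin_le_cond.
  apply: (big_ind (fun a => 0 < a)) => // [a b a0 b0|j _]; first by rewrite lt_min a0.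
  by case: (Hd j).
exists e => //.
have near_c : nbhs u [set y : 'rV[R]_n | forall j, d j < (c j).@[y 0]].
  apply: (@filter_forall _ _ (fun j => [set y : 'rV[R]_n | d j < (c j).@[y 0]]) (nbhs u)).
  by move=> j; apply: meval_near_gt; case: (Hd j).
apply: filterS near_c => y /= hc Sy.
rewrite FE mevalD -[leLHS]add0r; apply: lerD; first exact: (qmodule_ge0 Mtau Sy).
rewrite mulr_sumr meval_sum; apply: ler_sum => j _.
rewrite mevalM mevalXn mevalB mevalXU mevalC mulrC ler_wpM2l ?sqr_ge0 //.
by rewrite (le_trans (ed j)) // ltW.
Qed.

(* The coefficients of the local certificate at [u], damped away from [u] and
   corrected by a multiple of [F], are positive off the remaining zeros. *)
Lemma damped_coefficient_pos F u (Z : seq 'rV[R]_n) (X c : {mpoly R[n]}) :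
  unit_sphere u -> (forall y, S y -> 0 <= F.@[y 0]) ->
  (forall y, S y -> F.@[y 0] = 0 -> y \in u :: Z) ->
  (forall x, x \in Z -> unit_sphere x /\ local_certificate h g F x) ->
  u \notin Z -> unit_mod_gap u X ->
  (forall y, unit_sphere y -> `|X.@[y 0]| <= 1) ->
  (forall x, x \in Z -> exists2 Y, forall y, unit_sphere y -> `|Y.@[y 0]| <= 1
        & X = (1 - ((gap u).@[x 0])^-1 *: gap u) * Y) ->
  0 < c.@[u 0] ->
  exists k0, forall k, (k0 <= k)%N -> forall y, S y -> y \notin Z ->
    0 < (X ^+ 4 * taper u ^+ (k + k) * c).@[y 0] + F.@[y 0] / 4%:R.
Proof.
move=> u1 F0 FZ Zcert uZ [w [XE _]] X1 HX c0.
pose Q (A : set 'rV[R]_n) := exists k0, forall k, (k0 <= k)%N -> forall y,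
  A y -> S y -> y \notin Z ->
    0 < (X ^+ 4 * taper u ^+ (k + k) * c).@[y 0] + F.@[y 0] / 4%:R.
suff [k0 H] : Q S by exists k0 => k kk y Sy; apply: H.
have Ssph y : S y -> unit_sphere y := @semialg_set_sphere _ _ _ _ h g hsph y.
apply: (compact_ind (semialg_set_compact hsph)) => //.
- by exists 0%N.
- by move=> A B AB [k0 H]; exists k0 => k kk y /AB; exact: H.
- move=> A B [a HA] [b HB]; exists (maxn a b) => k.
  by rewrite geq_max => /andP[ak bk] y [Ay|By]; [exact: HA | exact: HB].
move=> x Sx; have x1 := Ssph _ Sx.
(* Near u every factor of the damped term is positive, whatever k is. *)
have [-> {x Sx x1}|xu] := eqVneq x u.
  have Xu : X.@[u 0] = 1 by rewrite XE mevalB meval1 mevalM gap_self // mul0r subr0.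
  have bu : (taper u).@[u 0] = 1 by rewrite meval_taper gap_self // mul0r subr0.
  exists ([set y : 'rV[R]_n | 0 < X.@[y 0]] `&` [set y : 'rV[R]_n | 0 < (taper u).@[y 0]]
     `&` [set y : 'rV[R]_n | 0 < c.@[y 0]]).
    by apply: filterI; [apply: filterI|]; apply: meval_near_gt; rewrite ?Xu ?bu.
  exists 0%N => k _ y [_ [[/= Xy by0] cy]] Sy _.
  have := F0 y Sy; suff : 0 < (X ^+ 4 * taper u ^+ (k + k) * c).@[y 0] by lra.
  by rewrite !mevalM !mevalXn !mulr_gt0 // exprn_gt0.
have tx := gap_gt0 u1 x1 xu; set t := (gap u).@[x 0] in tx *.
have tx2 : t <= 2%:R by exact: gap_le2.
pose U := [set y : 'rV[R]_n | t / 2%:R < (gap u).@[y 0]]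
  `&` [set y : 'rV[R]_n | `|c.@[y 0]| <= `|c.@[x 0]| + 1].
have Ux : nbhs x U.
  apply: filterI; last exact: meval_near_bounded.
  by apply: meval_near_gt; rewrite -/t; lra.
pose C := `|c.@[x 0]| + 1.
(* On U the gap exceeds t / 2, so [taper u] is below 1 - t / 4. One factor X^2 is bounded by m, the
   other by 1. *)
have bound k y m : U y -> unit_sphere y -> X.@[y 0] ^+ 2 <= m ->
    - (C * (1 - t / 4%:R) ^+ (k + k) * m) <= (X ^+ 4 * taper u ^+ (k + k) * c).@[y 0].
  move=> [/= gy cy] y1 Xm; rewrite lerNl; apply: le_trans (ler_norm _) _.
  rewrite normrN !mevalM !mevalXn !normrM !normrX.
  have /andP[b0 b1] := taper01 u1 y1.
  have hb : `|(taper u).@[y 0]| ^+ (k + k) <= (1 - t / 4%:R) ^+ (k + k).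
    rewrite (ger0_norm b0) lerXn2r ?nnegrE //; first by lra.
    by rewrite meval_taper; lra.
  have hX : `|X.@[y 0]| ^+ 4 <= m.
    apply: le_trans Xm; rewrite (exprD _ 2 2) -[leRHS]mulr1 -(real_normK (num_real X.@[y 0])).
    apply: ler_wpM2l; first exact: sqr_ge0.
    by apply: exprn_ile1 => //; exact: X1.
  rewrite [leRHS](_ : _ = m * (1 - t / 4%:R) ^+ (k + k) * C); last by ring.
  have X4 : 0 <= `|X.@[y 0]| ^+ 4 by exact/exprn_ge0/normr_ge0.
  have b2k : 0 <= `|(taper u).@[y 0]| ^+ (k + k) by exact/exprn_ge0/normr_ge0.
  by apply: ler_pM; rewrite ?mulr_ge0 ?normr_ge0 //; exact: ler_pM.
have t4 : 0 < t / 4%:R by lra.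
have t41 : t / 4%:R <= 1 by lra.
(* At another zero both terms vanish, so rates are compared: X^2 <= |y - x|^2 / t^2 by the Lipschitz
   bound on the gap, against F >= e |y - x|^2. *)
have [xZ|xZ] := boolP (x \in Z).
  have [Y Y1 XY] := HX x xZ.
  have [_ /local_certificate_growth[e e0 growth]] := Zcert x xZ.
  exists (U `&` [set y : 'rV[R]_n | S y -> e * sqdist x y <= F.@[y 0]]); first exact: filterI.
  have a0 : 0 < e * t ^+ 2 / 4%:R by rewrite divr_gt0 // mulr_gt0 // exprn_gt0.
  have [k0 Hk0] := geometric_decay C t4 t41 a0.
  exists k0 => k kk y [_ [Uy gy]] Sy yZ; have y1 := Ssph y Sy.
  have yx : y != x by apply: contraNneq yZ => ->.
  have d0 := sqdist_gt0 yx.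
  have Xm : X.@[y 0] ^+ 2 <= sqdist x y / t ^+ 2.
    rewrite XY mevalM exprMn mevalB meval1 mevalZ -/t.
    apply: (@le_trans _ _ ((1 - t^-1 * (gap u).@[y 0]) ^+ 2 * 1)).
      rewrite ler_wpM2l ?sqr_ge0 // -real_normK ?num_real //.
      by rewrite exprn_ile1 // Y1.
    rewrite mulr1 -[X in (X - _) ^+ 2](mulVf (lt0r_neq0 tx)) -mulrBr exprMn mulrC exprVn.
    rewrite ler_wpM2r ?invr_ge0 ?exprn_ge0 ?(ltW tx) //.
    exact: sqr_gapB.
  have := bound k y _ Uy y1 Xm; have := gy Sy; have := Hk0 k kk.
  set q := C * _ => q1 Fy; set B := meval _ _.
  have : q * (sqdist x y / t ^+ 2) < e * sqdist x y / 4%:R.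
    rewrite mulrA ltr_pdivrMr ?exprn_gt0 //.
    have := q1; rewrite -(ltr_pM2r d0); lra.
  lra.
have Fx : 0 < F.@[x 0].
  rewrite lt0r F0 // andbT; apply/eqP => Fx0; have := FZ x Sx Fx0.
  by rewrite inE (negbTE xu) (negbTE xZ).
exists (U `&` [set y : 'rV[R]_n | F.@[x 0] / 2%:R < F.@[y 0]]).
  by apply: filterI => //; apply: meval_near_gt; lra.
have a0 : 0 < F.@[x 0] / 8%:R by lra.
have [k0 Hk0] := geometric_decay C t4 t41 a0.
exists k0 => k kk y [_ [Uy /= Fy]] Sy yZ; have y1 := Ssph y Sy.
have Xm : X.@[y 0] ^+ 2 <= 1 by rewrite -real_normK ?num_real // exprn_ile1 // X1.
have := bound k y _ Uy y1 Xm; have := Hk0 k kk; lra.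
Qed.

Lemma local_global_finite (Z : seq 'rV[R]_n) F : uniq Z ->
  (forall x, x \in Z -> S x /\ local_certificate h g F x) ->
  (forall y, S y -> 0 <= F.@[y 0]) ->
  (forall y, S y -> F.@[y 0] = 0 -> y \in Z) -> M F.
Proof.
elim: Z F => [|u Z IH] F.
  move=> _ _ F0 FZ; apply: putinar => // y Sy; rewrite lt0r F0 // andbT.
  by apply/eqP => /(FZ y Sy).
move=> /= /andP[uZ Zuniq] cert F0 FZ.
have Ssph y : S y -> unit_sphere y := @semialg_set_sphere _ _ _ _ h g hsph y.
have [Su /local_certificate_diag[tau [c [Mtau c0 FE]]]] := cert u (mem_head _ _).
have u1 := Ssph u Su.
have Zcert x : x \in Z -> S x /\ local_certificate h g F x.
  by move=> xZ; apply: cert; rewrite inE xZ orbT.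
have Z1 x : x \in Z -> unit_sphere x by move=> /Zcert[/Ssph].
have [X [uX X1 HX]] := separating_multiplier u1 uZ Z1.
have /choice[K HK] : forall j, exists k0, forall k, (k0 <= k)%N -> forall y, S y ->
    y \notin Z -> 0 < (X ^+ 4 * taper u ^+ (k + k) * c j).@[y 0] + F.@[y 0] / 4%:R.
  move=> j; apply: damped_coefficient_pos => // x xZ.
  by have [/Ssph] := Zcert x xZ.
(* One step beyond the thresholds gives B an extra factor (taper u)^2, which forces w >= 1 at u.
   Away from u, B <= taper u means 1 - B >= gap u / 2, that is w >= 1/2. *)
pose k := (\max_j K j).+1.
have Kk j : (K j <= k)%N by rewrite ltnW // ltnS leq_bigmax.
pose B := X ^+ 4 * taper u ^+ (k + k).
have Bsq : B = (X ^+ 2 * taper u ^+ k) ^+ 2.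
  by rewrite /B exprMn -(exprM X 2 2) -exprM !muln2 addnn.
have [w [BE w0]] : exists w, B = 1 - gap u * w /\ 1 <= w.@[u 0].
  have ub : unit_mod_gap u (taper u) by apply: unit_mod_gap_scale; rewrite invr_ge0.
  have [a [aE a0]] : unit_mod_gap u (X ^+ 4 * taper u ^+ (\max_j K j + \max_j K j)).
    by apply: unit_mod_gapM => //; exact: unit_mod_gapX.
  exists (a + (1 - 4%:R^-1 *: gap u) * (1 - gap u * a)); split.
    have -> : B = X ^+ 4 * taper u ^+ (\max_j K j + \max_j K j) * (taper u * taper u).
      by rewrite /B /k addSn addnS !exprS; ring.
    rewrite aE /taper -!mul_mpolyC.
    have h4 : (4%:R^-1 : R)%:MP = (2%:R^-1)%:MP * (2%:R^-1)%:MP :> {mpoly R[n]}.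
      by rewrite -mpolyCM; congr mpolyC; field.
    have h2 : (2%:R^-1 : R)%:MP * 2%:R = 1 :> {mpoly R[n]}.
      by rewrite mulr_natr -mpolyCMn -mpolyC1; congr mpolyC; field.
    rewrite h4; set q := (2%:R^-1)%:MP in h2 *.
    have -> : (1 - q * gap u) * (1 - q * gap u) = 1 - gap u * (1 - q * q * gap u).
      transitivity (1 - (q * 2%:R) * gap u + q * q * gap u * gap u); first by ring.
      by rewrite h2; ring.
    by ring.
  rewrite mevalD mevalM !mevalB !meval1 mevalZ mevalM gap_self // mul0r mulr0 subr0 mulr1.
  by rewrite lerDr.
have w12 y : unit_sphere y -> 2%:R^-1 <= w.@[y 0].
  move=> y1; have [->|yu] := eqVneq y u; first by apply: le_trans w0; lra.
  have gy := gap_gt0 u1 y1 yu; rewrite -(ler_pM2l gy).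
  have e1 : B.@[y 0] = 1 - (gap u).@[y 0] * w.@[y 0] by rewrite BE mevalB meval1 mevalM.
  suff : B.@[y 0] <= (taper u).@[y 0] by rewrite e1 meval_taper; lra.
  have /andP[b0 b1] := taper01 u1 y1.
  rewrite /B mevalM !mevalXn -[leRHS]mul1r; apply: ler_pM.
  - by rewrite (exprM _ 2 2) sqr_ge0.
  - exact: exprn_ge0.
  - apply: le_trans (ler_norm _) _; rewrite normrX.
    by apply: exprn_ile1 => //; exact: X1.
  - by rewrite /k addSn exprS ler_piMr // exprn_ile1.
pose v := 2%:R^-1 *: w.
have v4 y : unit_sphere y -> 4%:R^-1 <= v.@[y 0].
  by move=> y1; rewrite mevalZ; have := w12 y y1; lra.
have Mv p : M p -> M (v * p).
  apply: qmoduleM_sos_mod; apply: sphere_pos_sos_mod => // y y1.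
  by apply: lt_le_trans (v4 y y1); rewrite invr_gt0.
pose c' j := B * c j + v * F.
have c'lb j y : S y -> (B * c j).@[y 0] + F.@[y 0] / 4%:R <= (c' j).@[y 0].
  move=> Sy; rewrite mevalD lerD2l mevalM mulrC; apply: ler_wpM2r; first exact: F0.
  exact: v4 (Ssph y Sy).
have Mc' j : M (c' j).
  (* At points of S outside Z, in particular at u, c'_j is at least B c_j + F / 4 > 0, so the
     shorter list Z contains all its zeros. *)
  apply: IH => //.
  - move=> x xZ; have [Sx [tau' Mtau' nd]] := Zcert x xZ; split=> //.
    exists (v * tau'); first exact: Mv.
    have [Y _ XY] := HX x xZ; set l := 1 - _ *: _ in XY.
    have l0 : l.@[x 0] = 0.
      rewrite mevalB meval1 mevalZ mulVf ?subrr // gt_eqF //.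
      by apply: gap_gt0 => //; [exact: Z1 | apply: contraNneq uZ => <-].
    (* X, and with it B, contains powers of the factor l vanishing at x: B c_j has order at least
       four there, and v (F - tau') alone decides the Hessian. *)
    have -> : c' j - v * tau'
        = v * (F - tau') + l * (l * (l * (l * Y ^+ 4 * taper u ^+ (k + k) * c j))).
      by rewrite /c' /B XY; ring.
    apply: nondegenerate_zeroM => //; apply: lt_le_trans (v4 _ (Z1 x xZ)).
    by rewrite invr_gt0.
  - move=> y Sy; apply: le_trans (c'lb j y Sy).
    have [yZ|yZ] := boolP (y \in Z); last by rewrite ltW // HK.
    rewrite !mevalM mevalXn (_ : X.@[y 0] = 0) ?expr0n ?mul0r ?add0r ?divr_ge0 ?F0 //.
    have [Y _ ->] := HX y yZ; rewrite mevalM mevalB meval1 mevalZ mulVf ?subrr ?mul0r //.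
    rewrite gt_eqF //; apply: gap_gt0 => //; first exact: Z1.
    by apply: contraNneq uZ => <-.
  - move=> y Sy cy; apply/negPn/negP => yZ.
    by have := HK j k (Kk j) y Sy yZ; have := c'lb j y Sy; rewrite cy -/B; lra.
(* [F = B F + (1 - B) F] with [1 - B = gap u * w], and [2 gap u] is
   [\sum_j (X_j - u_j)^2] on the sphere. *)
have FE' : F = B * tau + \sum_j ('X_j - (u 0 j)%:MP) ^+ 2 * c' j
    - (v * F) * (sqnorm R n - 1).
  have FT : F - tau = \sum_j ('X_j - (u 0 j)%:MP) ^+ 2 * c j by rewrite {1}FE addrC addKr.
  have -> : \sum_j ('X_j - (u 0 j)%:MP) ^+ 2 * c' j
      = B * (F - tau) + v * F * ((sqnorm R n - 1) + 2%:R *: gap u).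
    rewrite -sqdist_gap_mod // FT !mulr_sumr -big_split; apply: eq_bigr => j _.
    by rewrite /c' /=; ring.
  have v2 : v * 2%:R = w by rewrite mulr_natr /v -scaler_nat scalerA mulfV ?pnatr_eq0 // scale1r.
  transitivity (B * F + (v * 2%:R) * gap u * F); first by rewrite v2 BE; ring.
  by rewrite scaler_nat; ring.
rewrite FE'; apply: qmoduleD; last first.
  by apply: qmodule_ideal; apply: idealN; exact: idealM.
apply: qmoduleD; first by rewrite Bsq; apply: qmoduleM; [exact: sos_sq | exact: Mtau].
by apply: qmodule_sum => j _; apply: qmoduleM; [exact: sos_sq | exact: Mc'].
Qed.

(** Quadratic growth makes each zero isolated in the zero set, and compactness then leaves finitely
    many. *)
Theorem local_global F :
  (forall y, S y -> 0 <= F.@[y 0]) ->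
  (forall y, S y -> F.@[y 0] = 0 -> local_certificate h g F y) -> M F.
Proof.
move=> F0 cert.
pose Q (A : set 'rV[R]_n) := exists Z : seq 'rV[R]_n, forall y,
  A y -> S y -> F.@[y 0] = 0 -> y \in Z.
have [Z HZ] : Q S.
  apply: (compact_ind (semialg_set_compact hsph)).
  - by exists [::].
  - by move=> A B AB [Z H]; exists Z => y /AB; exact: H.
  - move=> A B [Z H] [Z' H']; exists (Z ++ Z') => y [Ay|By] Sy Fy; rewrite mem_cat.
      by rewrite H.
    by rewrite H' ?orbT.
  move=> x Sx; have [Fx|Fx] := eqVneq F.@[x 0] 0.
    have [e e0 growth] := local_certificate_growth (cert x Sx Fx).
    exists [set y : 'rV[R]_n | S y -> e * sqdist x y <= F.@[y 0]] => //.
    exists [:: x] => y [_ /= gy] Sy Fy; rewrite inE; apply/negPn/negP => /sqdist_gt0 d0.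
    by have := gy Sy; rewrite Fy leNgt mulr_gt0.
  exists [set y : 'rV[R]_n | 0 < F.@[y 0]].
    by apply: meval_near_gt; rewrite lt0r Fx F0.
  by exists [::] => y [_ /= Fy] _ F00; rewrite F00 ltxx in Fy.
apply: (@local_global_finite [seq y <- undup Z | `[< S y /\ F.@[y 0] = 0 >]]) => //.
- by rewrite filter_uniq ?undup_uniq.
- by move=> x; rewrite mem_filter => /andP[/asboolP[Sx Fx] _]; split=> //; exact: cert.
- move=> y Sy Fy; rewrite mem_filter mem_undup HZ // andbT; exact/asboolP.
Qed.

End LocalGlobalPrinciple.

(** * Homogenization *)

Section Homogenization.
Context (R : realType) (n : nat).
Implicit Types (p q : {mpoly R[n]}) (Q : {mpoly R[n.+1]}) (x w : 'rV[R]_n)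
  (u v : 'rV[R]_n.+1).

Lemma at_infinity0 x : at_infinity x 0 ord0 = 0.
Proof.
have -> : (ord0 : 'I_n.+1) = lshift n (ord0 : 'I_1) by exact/val_inj.
by rewrite [LHS](@row_mxEl R 1 1 n) mxE.
Qed.

Lemma at_infinityS x i : at_infinity x 0 (lift ord0 i) = x 0 i.
Proof.
have -> : lift (ord0 : 'I_n.+1) i = rshift 1 i by exact/val_inj.
exact: (@row_mxEr R 1 1 n).
Qed.

Definition dehomogenize Q : {mpoly R[n]} :=
  Q \mPo [tuple oapp (fun j => 'X_j) 1 (unlift ord0 i) | i < n.+1].

Lemma dehomogenizeD : {morph dehomogenize : p q / p + q}.
Proof. exact: comp_mpolyD. Qed.

Lemma dehomogenizeM : {morph dehomogenize : p q / p * q}.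
Proof. exact: rmorphM. Qed.

Lemma dehomogenizeXn k : {morph dehomogenize : p / p ^+ k}.
Proof. exact: rmorphXn. Qed.

Lemma dehomogenizeC c : dehomogenize c%:MP = c%:MP.
Proof. exact: comp_mpolyC. Qed.

Lemma dehomogenizeZ c Q : dehomogenize (c *: Q) = c *: dehomogenize Q.
Proof. exact: comp_mpolyZ. Qed.

Lemma dehomogenizeB : {morph dehomogenize : p q / p - q}.
Proof. exact: comp_mpolyB. Qed.

Lemma dehomogenize0 : dehomogenize 0 = 0.
Proof. exact: comp_mpoly0. Qed.

Lemma dehomogenize_sum (J : Type) (r : seq J) (P : pred J) (F : J -> {mpoly R[n.+1]}) :
  dehomogenize (\sum_(i <- r | P i) F i) = \sum_(i <- r | P i) dehomogenize (F i).
Proof. exact: raddf_sum. Qed.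

Lemma dehomogenize_prod (J : Type) (r : seq J) (P : pred J) (F : J -> {mpoly R[n.+1]}) :
  dehomogenize (\prod_(i <- r | P i) F i) = \prod_(i <- r | P i) dehomogenize (F i).
Proof. exact: rmorph_prod. Qed.

Lemma dehomogenizeX0 : dehomogenize 'X_ord0 = 1.
Proof. by rewrite /dehomogenize comp_mpolyXU -tnth_nth tnth_mktuple unlift_none. Qed.

Lemma dehomogenizeX i : dehomogenize 'X_(lift ord0 i) = 'X_i.
Proof. by rewrite /dehomogenize comp_mpolyXU -tnth_nth tnth_mktuple liftK. Qed.

Lemma dehomogenize_homogenize p : dehomogenize (homogenize p) = p.
Proof.
rewrite /homogenize dehomogenize_sum.
transitivity (\sum_(k < (mtdeg p).+1) pihomog mdeg k p); last first.
  by rewrite -pihomog_partitionE //; exact: leqSpred.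
apply: eq_bigr => k _.
rewrite dehomogenizeM dehomogenizeXn dehomogenizeX0 expr1n mul1r.
rewrite comp_mpolyE dehomogenize_sum [RHS]mpolyE; apply: eq_bigr => m _.
rewrite dehomogenizeZ dehomogenize_prod mpolyXE_id; congr (_ *: _).
by apply: eq_bigr => i _; rewrite dehomogenizeXn tnth_mktuple dehomogenizeX.
Qed.

Lemma dhomogXn (k d : nat) (i : 'I_k) : ('X_i ^+ d : {mpoly R[k]}) \is d.-homog.
Proof.
have X1 : ('X_i : {mpoly R[k]}) \is 1.-homog by rewrite dhomogX /= mdeg1.
by have := dhomogMn d X1; rewrite mul1n.
Qed.

Lemma homogenize_dhomog p : homogenize p \is (mtdeg p).-homog.
Proof.
apply: rpred_sum => k _.
have kd : (k <= mtdeg p)%N by rewrite -ltnS.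
suff hk : (pihomog mdeg k p \mPo [tuple 'X_(lift ord0 i) | i < n]
    : {mpoly R[n.+1]}) \is k.-homog.
  by have := dhomogM (dhomogXn (mtdeg p - k) ord0) hk; rewrite subnK.
rewrite comp_mpolyE big_seq; apply: rpred_sum => m mS; apply: rpredZ.
have /dhomogP/(_ m mS) /= <- := pihomogP mdeg k p.
rewrite mdegE.
apply: (big_ind2 (fun (q : {mpoly R[n.+1]}) e => q \is e.-homog)) => [|q e q' e'|i _].
- exact: dhomog1.
- exact: dhomogM.
by rewrite tnth_mktuple; exact: dhomogXn.
Qed.

Lemma dhomog_eval d Q u x : Q \is d.-homog -> u 0 ord0 != 0 ->
  (forall i, x 0 i = u 0 (lift ord0 i) / u 0 ord0) ->
  Q.@[u 0] = u 0 ord0 ^+ d * (dehomogenize Q).@[x 0].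
Proof.
move=> /dhomogP hQ u0 xE; rewrite comp_mpoly_meval !mevalE mulr_sumr.
rewrite big_seq [RHS]big_seq; apply: eq_bigr => m mQ.
rewrite mulrCA; congr (_ * _); rewrite -(hQ m mQ) /= mdegE -prodrXr -big_split.
apply: eq_bigr => i _ /=; rewrite -exprMn tnth_mktuple; congr (_ ^+ _).
case: unliftP => [j ->|->] /=; last by rewrite meval1 mulr1.
by rewrite mevalXU xE mulrC divfK.
Qed.

(** The second conjunct covers d = 0, where [d.-1] truncates and homogeneity of degree 0 would be
    too weak. *)
Lemma dhomog_mderiv (k d : nat) (p : {mpoly R[k]}) i : p \is d.-homog ->
  p^`M(i) \is d.-1.-homog /\ (d = 0%N -> p^`M(i) = 0).
Proof.
move=> hp.
have hm m : (p^`M(i))@_m != 0 -> (mdeg m).+1 = d.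
  rewrite mcoeff_deriv => nz; apply/eqP; apply: contraNT nz => md.
  suff -> : p@_(m + U_(i)) = 0 by rewrite mul0rn.
  by apply: (dhomog_nemf_coeff hp); rewrite /= mdegD mdeg1 addn1.
split; first by apply/dhomogP => m; rewrite mcoeff_msupp => /hm <-.
move=> d0; apply/mpolyP => m; rewrite mcoeff0; apply/eqP/negPn/negP => /hm.
by rewrite d0.
Qed.

Lemma dhomog_dird (k d : nat) (p : {mpoly R[k]}) (y : 'rV[R]_k) : p \is d.-homog ->
  dird y p \is d.-1.-homog /\ (d = 0%N -> dird y p = 0).
Proof.
move=> hp; split.
  by apply: rpred_sum => i _; apply: rpredZ; case: (dhomog_mderiv i hp).
move=> d0; rewrite /dird big1 // => i _.
by have [_ ->] := dhomog_mderiv i hp; rewrite ?scaler0.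
Qed.

Lemma euler (k d : nat) (p : {mpoly R[k]}) (y : 'rV[R]_k) : p \is d.-homog ->
  (dird y p).@[y 0] = d%:R * p.@[y 0].
Proof.
move=> /dhomogP hp; rewrite [p]mpolyE dird_sum !meval_sum mulr_sumr.
rewrite big_seq [RHS]big_seq; apply: eq_bigr => m mp.
rewrite dirdZ !mevalZ mulrCA; congr (_ * _); rewrite -(hp m mp) /=.
rewrite mpolyXE_id mdegE.
pose K (q : {mpoly R[k]}) (e : nat) := (dird y q).@[y 0] = e%:R * q.@[y 0].
apply: (big_rec2 K) => [|i e q _ IH].
  by rewrite /K -mpolyC1 dirdC meval0 mul0r.
rewrite /K dirdM mevalD !mevalM IH natrD mulrDl; congr (_ + _); last by ring.
rewrite mulrA; congr (_ * _); elim: (m i) => [|j IHj].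
  by rewrite expr0 -mpolyC1 dirdC meval0 mul0r.
by rewrite exprS dirdM mevalD !mevalM IHj dirdX mevalC mevalXU -[j.+1]addn1 natrD; ring.
Qed.

Lemma dehomogenize_dird w Q :
  dehomogenize (dird (at_infinity w) Q) = dird w (dehomogenize Q).
Proof.
pose K Q := dehomogenize (dird (at_infinity w) Q) = dird w (dehomogenize Q).
have KM A B : K A -> K B -> K (A * B).
  by move=> hA hB; rewrite /K dirdM dehomogenizeD !dehomogenizeM hA hB dirdM.
have KC c : K c%:MP by rewrite /K dirdC dehomogenize0 dehomogenizeC dirdC.
suff : K Q by [].
elim/mpolyind: Q => [|c m Q _ _ IH]; first by rewrite -mpolyC0; exact: KC.
rewrite /K dirdD !dehomogenizeD dirdD IH; congr (_ + _).
rewrite -mul_mpolyC; apply: (KM); first exact: KC.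
have K1 : K 1 by rewrite -mpolyC1; exact: KC.
rewrite mpolyXE_id; apply: (big_ind K); [exact: K1 | exact: KM | move=> i _].
elim: (m i) => [|k IHk]; first by rewrite expr0; exact: K1.
rewrite exprS; apply: KM; last exact: IHk.
rewrite /K dirdX dehomogenizeC.
case: (unliftP ord0 i) => [j|] ->.
  by rewrite dehomogenizeX dirdX at_infinityS.
by rewrite dehomogenizeX0 -mpolyC1 dirdC at_infinity0 mpolyC0.
Qed.

(** A direction with zero x_0 component commutes with setting x_0 = 1. The factor x_0 on the left
    avoids the exponent d - 1, so that d = 0 is included. *)
Lemma dhomog_dird_eval d Q u x w : Q \is d.-homog -> u 0 ord0 != 0 ->
  (forall i, x 0 i = u 0 (lift ord0 i) / u 0 ord0) ->
  u 0 ord0 * (dird (at_infinity w) Q).@[u 0]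
  = u 0 ord0 ^+ d * (dird w (dehomogenize Q)).@[x 0].
Proof.
move=> hQ u0 xE; have [hd hd0] := dhomog_dird (at_infinity w) hQ.
rewrite -dehomogenize_dird; case: d hQ hd hd0 => [|d] _ hd hd0.
  by rewrite hd0 // dehomogenize0 !meval0 !mulr0.
by rewrite (dhomog_eval hd u0 xE) mulrA -exprS.
Qed.

Lemma dhomog_dird2_eval d Q u x w : Q \is d.-homog -> u 0 ord0 != 0 ->
  (forall i, x 0 i = u 0 (lift ord0 i) / u 0 ord0) ->
  u 0 ord0 ^+ 2 * (dird (at_infinity w) (dird (at_infinity w) Q)).@[u 0]
  = u 0 ord0 ^+ d * (dird w (dird w (dehomogenize Q))).@[x 0].
Proof.
move=> hQ u0 xE; have [hd hd0] := dhomog_dird (at_infinity w) hQ.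
rewrite -dehomogenize_dird expr2 -mulrA (dhomog_dird_eval w hd u0 xE) mulrA -exprS.
case: d hQ hd hd0 => [|d] // _ hd hd0.
by rewrite hd0 // dehomogenize0 linear0 !meval0 !mulr0.
Qed.

(** Euler's identity handles the radial part, dehomogenization the part with zero x_0 component. *)
Lemma radial_decomposition u v : u 0 ord0 != 0 ->
  exists a w, v = a *: u + at_infinity w.
Proof.
move=> u0; pose a := v 0 ord0 / u 0 ord0.
exists a, (\row_i (v 0 (lift ord0 i) - a * u 0 (lift ord0 i))).
apply/rowP => i; rewrite 2!mxE; case: (unliftP ord0 i) => [j|] ->.
  by rewrite at_infinityS mxE addrC subrK.
by rewrite at_infinity0 addr0 /a divfK.
Qed.

Lemma dird_radial d Q u w a : Q \is d.-homog ->
  (dird (a *: u + at_infinity w) Q).@[u 0]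
  = a * d%:R * Q.@[u 0] + (dird (at_infinity w) Q).@[u 0].
Proof. by move=> hQ; rewrite dirdDl dirdZl mevalD mevalZ (euler u hQ) mulrA. Qed.

(** The values of b and c are irrelevant: they multiply quantities that vanish at the zeros of
    interest, after weighting by the multipliers. *)
Lemma dird2_radial d Q u w a : Q \is d.-homog ->
  exists b c, (dird (a *: u + at_infinity w) (dird (a *: u + at_infinity w) Q)).@[u 0]
  = b * Q.@[u 0] + c * (dird (at_infinity w) Q).@[u 0]
    + (dird (at_infinity w) (dird (at_infinity w) Q)).@[u 0].
Proof.
move=> hQ; have [hu _] := dhomog_dird u hQ; have [hw _] := dhomog_dird (at_infinity w) hQ.
exists (a ^+ 2 * d.-1%:R * d%:R), (2%:R * a * d.-1%:R).
rewrite !dirdDl !dirdZl !dirdD !dirdZ (dird_comm (at_infinity w) u).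
rewrite !mevalD !mevalZ !mevalD !mevalZ (euler u hu) (euler u hw) (euler u hQ); ring.
Qed.

End Homogenization.

(** * Transfer of optimality conditions from affine minimizers to the sphere *)

Section Transfer.
Context (R : realType) (n : nat) (E I : finType).
Implicit Types (u v : 'rV[R]_n.+1) (x w : 'rV[R]_n).

Lemma sum_option_sum (V : zmodType) (T : option E + I -> V) :
  \sum_i T i = T (inl None) + \sum_(i : E + I)
    T (match i with inl e => inl (Some e) | inr j => inr j end).
Proof.
rewrite !big_sumType /= addrA; congr (_ + _).
rewrite (bigD1 None) //=; congr (_ + _).
rewrite (reindex_omap Some id) => [|[]//]; apply: eq_bigl => e.
by rewrite eqxx.
Qed.

Lemma dird_sqnorm (k : nat) (y z : 'rV[R]_k) :
  (dird z (sqnorm R k)).@[y 0] = 2%:R * \sum_i y 0 i * z 0 i.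
Proof.
rewrite /sqnorm dird_sum meval_sum mulr_sumr; apply: eq_bigr => i _.
by rewrite expr2 dirdM dirdX mevalD !mevalM mevalC mevalXU; ring.
Qed.

Lemma grad_eq_dird (k : nat) (J : finType) (p : {mpoly R[k]}) (c : J -> {mpoly R[k]})
    (lam : J -> R) (y : 'rV[R]_k) :
  (forall z, (dird z p).@[y 0] = \sum_i lam i * (dird z (c i)).@[y 0]) ->
  grad p y = \sum_i lam i *: grad (c i) y.
Proof.
have gE (q : {mpoly R[k]}) i : grad q y 0 i = (dird (delta_mx 0 i) q).@[y 0].
  by rewrite meval_dird_grad -rowE [RHS]mxE [RHS]mxE.
move=> H; apply/rowP => i; rewrite gE H summxE; apply: eq_bigr => j _.
by rewrite mxE gE.
Qed.

Lemma dird_grad_eq (k : nat) (J : finType) (p : {mpoly R[k]}) (c : J -> {mpoly R[k]})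
    (lam : J -> R) (y z : 'rV[R]_k) : grad p y = \sum_i lam i *: grad (c i) y ->
  (dird z p).@[y 0] = \sum_i lam i * (dird z (c i)).@[y 0].
Proof.
move=> H; rewrite meval_dird_grad H (raddf_sum trmx) mulmx_sumr summxE.
by apply: eq_bigr => i _ /=; rewrite meval_dird_grad linearZ /= -scalemxAr mxE.
Qed.

Lemma optimality_transfer (P : problem R n E I) (F : {mpoly R[n.+1]})
    (gt : I -> {mpoly R[n.+1]}) (d : nat) (D : I -> nat) (m : R) u x :
  F \is d.-homog -> ~~ odd d -> dehomogenize F = obj P - m%:MP ->
  (forall j, gt j \is (D j).-homog) -> (forall j, ~~ odd (D j)) ->
  (forall j, dehomogenize (gt j) = ineqc P j) ->
  semialg_set (homog_eqc (eqc P)) gt u -> F.@[u 0] = 0 -> u 0 ord0 != 0 ->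
  (forall i, x 0 i = u 0 (lift ord0 i) / u 0 ord0) ->
  optimality_conditions P x ->
  local_certificate (homog_eqc (eqc P)) gt F u.
Proof.
move=> hF dE FE hg DE gE [hu gu] F0 u0 xE [_ [lam [[stat lam0 compl] scc sosc]]].
pose Q := Problem F (homog_eqc (eqc P)) gt.
pose c (i : E + I) : {mpoly R[n.+1]} :=
  match i with inl e => homogenize (eqc P e) | inr j => gt j end.
pose dg (i : E + I) : nat := match i with inl e => mtdeg (eqc P e) | inr j => D j end.
have hc i : c i \is (dg i).-homog by case: i => [e|j] /=; [exact: homogenize_dhomog|].
have cE i : dehomogenize (c i) = constr P i.
  by case: i => [e|j] /=; [exact: dehomogenize_homogenize|].
set s := u 0 ord0 in u0 xE *.
have cv i : (c i).@[u 0] = s ^+ dg i * (constr P i).@[x 0].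
  by rewrite (dhomog_eval (hc i) u0 xE) cE.
have c1 i w : s * (dird (at_infinity w) (c i)).@[u 0]
    = s ^+ dg i * (dird w (constr P i)).@[x 0].
  by rewrite (dhomog_dird_eval w (hc i) u0 xE) cE.
have c2 i w : s ^+ 2 * (dird (at_infinity w) (dird (at_infinity w) (c i))).@[u 0]
    = s ^+ dg i * (dird w (dird w (constr P i))).@[x 0].
  by rewrite (dhomog_dird2_eval w (hc i) u0 xE) cE.
have F1 w : s * (dird (at_infinity w) F).@[u 0] = s ^+ d * (dird w (obj P)).@[x 0].
  by rewrite (dhomog_dird_eval w hF u0 xE) FE dirdB dirdC subr0.
have F2 w : s ^+ 2 * (dird (at_infinity w) (dird (at_infinity w) F)).@[u 0]
    = s ^+ d * (dird w (dird w (obj P))).@[x 0].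
  by rewrite (dhomog_dird2_eval w hF u0 xE) FE (dirdB w (obj P)) dirdC subr0.
(* The powers of s come from comparing gradients of forms of degrees d and [dg i]. Even degrees keep
   the signs of the inequality multipliers although s may be negative. *)
pose mu i := s ^+ d / s ^+ dg i * lam i.
have muE i : mu i * s ^+ dg i = s ^+ d * lam i.
  by rewrite /mu mulrAC divfK // expf_neq0.
have sd : 0 < s ^+ d by rewrite exprn_even_gt0 // u0 orbT.
have s2 : 0 < s ^+ 2 by rewrite exprn_even_gt0 // u0 orbT.
(* The sphere gets multiplier 0: by Euler's identity the radial derivatives of F and of the weighted
   constraints already vanish at u. *)
pose lam' (i : option E + I) : R :=
  match i with inl None => 0 | inl (Some e) => mu (inl e) | inr j => mu (inr j) end.
pose inj (i : E + I) : option E + I :=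
  match i with inl e => inl (Some e) | inr j => inr j end.
have lam'E i : lam' (inj i) = mu i by case: i.
have constrE i : constr Q (inj i) = c i by case: i.
have muc i : mu i * (c i).@[u 0] = 0.
  rewrite cv mulrA muE -mulrA; case: i => [e|j] /=; last by rewrite compl mulr0.
  suff -> : (eqc P e).@[x 0] = 0 by rewrite !mulr0.
  have := hu (Some e); rewrite /= -/(c (inl e)) cv => /eqP.
  by rewrite mulf_eq0 expf_eq0 (negbTE u0) andbF /= => /eqP.
have FQ : feasible Q u by split.
have statQ v : (dird v F).@[u 0] = \sum_i lam' i * (dird v (constr Q i)).@[u 0].
  have [a [w ->]] := radial_decomposition v u0.
  rewrite (dird_radial _ _ _ hF) F0 mulr0 add0r sum_option_sum mul0r add0r.
  apply: (mulfI u0); rewrite F1 (dird_grad_eq w stat) !mulr_sumr.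
  apply: eq_bigr => i _; rewrite -/(inj i) lam'E constrE (dird_radial _ _ _ (hc i)).
  rewrite [mu i * _]mulrDr [mu i * (_ * (c i).@[_])]mulrCA muc mulr0 add0r.
  by rewrite [RHS]mulrCA c1 !mulrA muE.
apply: (@optimality_local_certificate _ _ _ _ Q u lam') => //.
- split; first exact: grad_eq_dird.
  + move=> j; rewrite /= /mu mulr_ge0 // divr_ge0 ?(ltW sd) //.
    by rewrite exprn_even_ge0 //= DE.
  + by move=> j; exact: muc (inr j).
- move=> j; have := scc j; have Dpos : 0 < s ^+ D j by rewrite exprn_even_gt0 // u0 orbT.
  have := lam0 j; rewrite le_eqVlt => /predU1P[<-|lj _].
    rewrite add0r => gj; rewrite /= [gt j](_ : _ = c (inr j)) // cv ltr_wpDl ?mulr_gt0 //.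
    rewrite /mu mulr_ge0 ?lam0 // divr_ge0 ?ltW //.
  apply: ltr_pwDl; last exact: gu.
  by rewrite /= /mu mulr_gt0 // divr_gt0.
move=> v v0 tan.
have act i : i \in active Q u -> (dird v (constr Q i)).@[u 0] = 0.
  by move=> /tan H; rewrite meval_dird_grad H mxE.
have uv : \sum_i u 0 i * v 0 i = 0.
  have : (dird v (constr Q (inl None))).@[u 0] = 0.
    by apply: act; rewrite inE; apply/eqP; exact: hu None.
  rewrite /= dirdB -mpolyC1 dirdC subr0 dird_sqnorm => /eqP.
  by rewrite mulf_eq0 pnatr_eq0 => /eqP.
have [a [w vE]] := radial_decomposition v u0.
(* With w = 0 the direction v would be radial, yet the sphere constraint makes it orthogonal to
   u. *)
have wn0 : w != 0.
  apply: contraNneq v0 => w0.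
  rewrite vE w0 (_ : a = 0) ?scale0r ?add0r.
    apply/eqP/rowP => i; rewrite [RHS]mxE; case: (unliftP ord0 i) => [j|] ->.
      by rewrite at_infinityS mxE.
    exact: at_infinity0.
  have : \sum_i u 0 i * v 0 i = a * \sum_i u 0 i ^+ 2.
    rewrite mulr_sumr; apply: eq_bigr => i _; rewrite vE w0 2!mxE.
    have -> : at_infinity (0 : 'rV[R]_n) 0 i = 0.
      case: (unliftP ord0 i) => [j|] ->; first by rewrite at_infinityS mxE.
      exact: at_infinity0.
    ring.
  have := hu None; rewrite /= mevalB meval1 meval_sqnorm => /eqP.
  by rewrite subr_eq0 => /eqP ->; rewrite uv mulr1 => <-.
have tanw i : i \in active P x -> (dird (at_infinity w) (c i)).@[u 0] = 0.
  rewrite inE => /eqP ci; have cu : (c i).@[u 0] = 0 by rewrite cv ci mulr0.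
  have := act (inj i); rewrite inE constrE cu eqxx => /(_ isT).
  by rewrite vE (dird_radial _ _ _ (hc i)) cu mulr0 add0r.
have mud i : mu i * (dird (at_infinity w) (c i)).@[u 0] = 0.
  have [/tanw ->|] := boolP (i \in active P x); first by rewrite mulr0.
  rewrite inE => ci; have cu : (c i).@[u 0] != 0 by rewrite cv mulf_neq0 // expf_neq0.
  by have /eqP := muc i; rewrite mulf_eq0 (negbTE cu) orbF => /eqP ->; rewrite mul0r.
have dF : (dird (at_infinity w) F).@[u 0] = 0.
  have := statQ (at_infinity w); rewrite sum_option_sum mul0r add0r => ->.
  by rewrite big1 // => i _; rewrite -/(inj i) lam'E constrE mud.
rewrite -meval_dird2.
have -> : (dird v (dird v (lagrangian Q lam'))).@[u 0]
    = (dird (at_infinity w) (dird (at_infinity w) F)).@[u 0]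
      - \sum_i mu i * (dird (at_infinity w) (dird (at_infinity w) (c i))).@[u 0].
  rewrite /lagrangian !dirdB mevalB dird2_sum [X in _ - X]meval_sum; congr (_ - _).
    by have [b [b' H]] := dird2_radial u w a hF; rewrite vE H F0 dF !mulr0 !add0r.
  rewrite sum_option_sum scale0r !raddf0 add0r; apply: eq_bigr => i _.
  rewrite -/(inj i) lam'E constrE !dirdZ mevalZ vE.
  have [b [b' ->]] := dird2_radial u w a (hc i).
  by rewrite !mulrDr mulrCA muc mulr0 mulrCA mud mulr0 !add0r.
rewrite -(pmulr_rgt0 _ s2) mulrBr F2.
have -> : s ^+ 2 * \sum_i mu i * (dird (at_infinity w) (dird (at_infinity w) (c i))).@[u 0]
    = s ^+ d * \sum_i lam i * (dird w (dird w (constr P i))).@[x 0].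
  rewrite [LHS]mulr_sumr [RHS]mulr_sumr; apply: eq_bigr => i _.
  by rewrite mulrCA c2 !mulrA muE.
rewrite -mulrBr pmulr_rgt0 //.
have -> : (dird w (dird w (obj P))).@[x 0] - \sum_i lam i * (dird w (dird w (constr P i))).@[x 0]
    = (dird w (dird w (lagrangian P lam))).@[x 0].
  rewrite /lagrangian !dirdB mevalB dird2_sum [X in _ = _ - X]meval_sum; congr (_ - _).
  by apply: eq_bigr => i _; rewrite !dirdZ mevalZ.
rewrite meval_dird2; apply: sosc => // i iact; apply/matrixP => k l.
rewrite !ord1 -meval_dird_grad mxE; apply: (mulfI (expf_neq0 (dg i) u0)).
by rewrite -c1 tanw // !mulr0.
Qed.

End Transfer.

(** * Dehomogenization of certificates *)

Section Dehomogenization.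
Context (R : realType) (n : nat).
Implicit Types (a b c : {mpoly R[n]}) (P Z : {poly {mpoly R[n]}}) (Q : {mpoly R[n.+1]}).

Definition dehom_weight : {mpoly R[n]} := 1 + sqnorm R n.

Lemma sos_dehom_weight : sos dehom_weight.
Proof. by apply: sosD; [exact: sos1 | apply: sos_sum => i _; exact: sos_sq]. Qed.

Lemma sosX (s : {mpoly R[n]}) k : sos s -> sos (s ^+ k).
Proof.
by move=> hs; elim: k => [|k IH]; [rewrite expr0; exact: sos1 | rewrite exprS; exact: sosM].
Qed.

Lemma dehom_weight_neq0 : dehom_weight != 0.
Proof.
apply/eqP => /(congr1 (meval ((0 : 'rV[R]_n) 0))); rewrite mevalD meval1 meval_sqnorm meval0.
by rewrite big1 ?addr0 => [/eqP|i _]; rewrite ?oner_eq0 // mxE expr0n.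
Qed.

Local Notation rho := dehom_weight.
Local Notation chart := ('X^2 * rho%:P - 1 : {poly {mpoly R[n]}}).

(* [P] reads [a + b X] with [X = 1 / sqrt rho], after clearing denominators,
   where [a] satisfies [T]. *)
Definition reduces (T : set {mpoly R[n]}) P : Prop :=
  exists k a b Z, T a /\ (rho ^+ k)%:P * P = a%:P + b%:P * 'X + Z * chart.

Lemma reducesD (T : set {mpoly R[n]}) P P' :
  (forall a b, T a -> T b -> T (a + b)) -> (forall a k, T a -> T (rho ^+ k * a)) ->
  reduces T P -> reduces T P' -> reduces T (P + P').
Proof.
move=> TD Tr [k [a [b [Z [Ta e]]]]] [k' [a' [b' [Z' [Ta' e']]]]].
exists (k + k')%N, (rho ^+ k' * a + rho ^+ k * a'), (rho ^+ k' * b + rho ^+ k * b').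
exists ((rho ^+ k')%:P * Z + (rho ^+ k)%:P * Z'); split; first by apply: TD; exact: Tr.
rewrite exprD rmorphM /= mulrDr.
transitivity ((rho ^+ k')%:P * ((rho ^+ k)%:P * P) + (rho ^+ k)%:P * ((rho ^+ k')%:P * P')).
  by ring.
by rewrite e e' !rmorphD !rmorphM /=; ring.
Qed.

Lemma reduces0 (T : set {mpoly R[n]}) : T 0 -> reduces T 0.
Proof. by exists 0%N, 0, 0, 0; split => //; rewrite mulr0 polyC0 !mul0r !addr0. Qed.

Lemma reduces_sum (T : set {mpoly R[n]}) (J : Type) (r : seq J) (p : pred J) (F : J -> {poly {mpoly R[n]}}) :
  T 0 -> (forall a b, T a -> T b -> T (a + b)) -> (forall a k, T a -> T (rho ^+ k * a)) ->
  (forall i, p i -> reduces T (F i)) -> reduces T (\sum_(i <- r | p i) F i).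
Proof.
move=> T0 TD Tr H; apply: big_ind => //; first exact: reduces0.
by move=> *; exact: reducesD.
Qed.

Lemma reducesC (T T' : set {mpoly R[n]}) c P : (forall a, T a -> T' (c * a)) ->
  reduces T P -> reduces T' (c%:P * P).
Proof.
move=> TT' [k [a [b [Z [Ta e]]]]]; exists k, (c * a), (c * b), (c%:P * Z).
by split; [exact: TT' | rewrite mulrCA e !rmorphM /=; ring].
Qed.

(** Horner's scheme: modulo the chart relation, rho X (a + b X) = b + rho a X, so each step costs
    one power of rho. *)
Lemma reducesT P : reduces setT P.
Proof.
elim/poly_ind: P => [|P c [k [a [b [Z [_ e]]]]]]; first exact: reduces0.
apply: reducesD => //; last first.
  by exists 0%N, c, 0, 0; split=> //; rewrite expr0 mul1r polyC0 !mul0r !addr0.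
exists k.+1, b, (rho * a), ((rho%:P) * 'X * Z + b%:P); split=> //.
transitivity (rho%:P * 'X * ((rho ^+ k)%:P * P)); first by rewrite exprS rmorphM /=; ring.
by rewrite e rmorphM /=; ring.
Qed.

Lemma reduces_chart P : reduces (set1 0) (P * chart).
Proof. by exists 0%N, 0, 0, P; split=> //; rewrite expr0 polyC0 mul0r !add0r mul1r. Qed.

(** Since rho X^2 = 1, the X-free part of rho (a + b X)^2 is rho a^2 + b^2, again a sum of
    squares. *)
Lemma reduces_sqr P : reduces (@sos R n) (P ^+ 2).
Proof.
have [k [a [b [Z [_ e]]]]] := reducesT P.
exists (k + k).+1, (rho * a ^+ 2 + b ^+ 2), (rho * a * b + rho * a * b).
exists (rho%:P * ((a%:P + b%:P * 'X) * Z + (a%:P + b%:P * 'X) * Z + Z ^+ 2 * chart)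
  + b%:P ^+ 2); split.
  apply: sosD; last exact: sos_sq.
  by apply: sosM; [exact: sos_dehom_weight | exact: sos_sq].
transitivity (rho%:P * ((rho ^+ k)%:P * P) ^+ 2); first by rewrite exprS exprD !rmorphM /=; ring.
rewrite e; move: (dehom_weight) => r.
by rewrite !polyCD !polyCM; ring.
Qed.

Lemma chart_power e : exists Z, (rho ^+ e)%:P * 'X^(e.*2) = 1 + Z * chart.
Proof.
elim: e => [|e [Z IH]]; first by exists 0; rewrite expr0 mul1r mul0r addr0.
exists ('X^2 * rho%:P * Z + 1); rewrite doubleS -addn2 exprD exprS rmorphM /=.
transitivity ('X^2 * rho%:P * ((rho ^+ e)%:P * 'X^(e.*2))); first by ring.
by rewrite IH; ring.
Qed.

Lemma reducesXn (T : set {mpoly R[n]}) P e : reduces T P -> reduces T (P * 'X^(e.*2)).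
Proof.
move=> [k [a [b [Z [Ta H]]]]]; have [Y HY] := chart_power e.
exists (k + e)%N, a, b, ((a%:P + b%:P * 'X) * Y + Z + Z * Y * chart); split=> //.
transitivity (((rho ^+ k)%:P * P) * ((rho ^+ e)%:P * 'X^(e.*2))).
  by rewrite exprD rmorphM /=; ring.
by rewrite H HY; ring.
Qed.

(** A nonzero multiple of [chart] has degree at least 2 in X, so 1 and X are independent modulo it
    and X-free parts can be compared. *)
Lemma chart_cancel a b Z : a%:P + b%:P * 'X = Z * chart -> a = 0.
Proof.
move=> e.
have sE : size (a%:P + b%:P * 'X) = if (b%:P == 0) && (a == 0) then 0%N else (size b%:P).+1.
  by rewrite addrC size_MXaddC.
have sX : size ('X^2 * rho%:P : {poly {mpoly R[n]}}) = 3%N.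
  by rewrite mulrC mul_polyC size_scale ?size_polyXn // dehom_weight_neq0.
have s3 : size chart = 3%N by rewrite size_polyDl sX // size_polyN size_poly1.
have c0 : chart != 0 by rewrite -size_poly_eq0 s3.
apply/eqP; move: sE; case: ifP => [/andP[_ //]|_]; rewrite e => h; exfalso.
have : ((size b%:P).+1 <= 2)%N := size_polyC_leq1 b.
have : Z * chart != 0 by rewrite -size_poly_gt0 h.
rewrite mulf_eq0 negb_or -h => /andP[Z0 _].
by rewrite size_mul // s3 addn3 /= !ltnS leqn0 size_poly_eq0 (negbTE Z0).
Qed.

(** The substitution (x_0, x) = X (1, x), with X a formal stand-in for 1 / sqrt rho. *)
Definition grade Q : {poly {mpoly R[n]}} :=
  mmap (polyC \o @mpolyC n R)
    (fun i => (oapp (fun j => 'X_j) 1 (unlift ord0 i))%:P * 'X) Q.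

Lemma gradeD : {morph grade : p q / p + q}.
Proof. exact: raddfD. Qed.

Lemma gradeB : {morph grade : p q / p - q}.
Proof. exact: raddfB. Qed.

Lemma gradeM : {morph grade : p q / p * q}.
Proof. exact: rmorphM. Qed.

Lemma gradeXn k : {morph grade : p / p ^+ k}.
Proof. exact: rmorphXn. Qed.

Lemma grade1 : grade 1 = 1.
Proof. exact: rmorph1. Qed.

Lemma grade_sum (J : Type) (r : seq J) (p : pred J) (F : J -> {mpoly R[n.+1]}) :
  grade (\sum_(i <- r | p i) F i) = \sum_(i <- r | p i) grade (F i).
Proof. exact: raddf_sum. Qed.

Lemma grade_dhomog d Q : Q \is d.-homog -> grade Q = (dehomogenize Q)%:P * 'X^d.
Proof.
move=> /dhomogP hQ; rewrite /grade /mmap /dehomogenize comp_mpolyE.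
rewrite rmorph_sum mulr_suml big_seq [RHS]big_seq; apply: eq_bigr => m mQ /=.
rewrite -mul_mpolyC rmorphM /= -mulrA; congr (_ * _).
rewrite rmorph_prod -(hQ m mQ) /= mdegE -prodrXr -big_split; apply: eq_bigr => i _ /=.
by rewrite rmorphXn exprMn tnth_mktuple.
Qed.

Lemma grade_sphere : grade (sqnorm R n.+1 - 1) = chart.
Proof.
rewrite gradeB grade1; congr (_ - _).
have hs : sqnorm R n.+1 \is 2.-homog by apply: rpred_sum => i _; exact: dhomogXn.
rewrite (grade_dhomog hs) mulrC; congr (_ * _%:P).
rewrite dehomogenize_sum big_ord_recl dehomogenizeXn dehomogenizeX0 expr1n; congr (_ + _).
by apply: eq_bigr => i _; rewrite dehomogenizeXn dehomogenizeX.
Qed.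

(** An inequality form of even degree becomes c_j times an even power of X, that is c_j over a power
    of rho, so its multiplier keeps a sum of squares as X-free part. The X-free part of the whole
    identity is thus a certificate, and the rest is discarded. *)
Lemma dehomogenize_certificate (E I : finType) (cE : E -> {mpoly R[n]})
    (cI : I -> {mpoly R[n]}) (gt : I -> {mpoly R[n.+1]}) (D : I -> nat)
    (F : {mpoly R[n.+1]}) (d : nat) :
  F \is d.-homog -> ~~ odd d ->
  (forall j, gt j \is (D j).-homog) -> (forall j, ~~ odd (D j)) ->
  (forall j, dehomogenize (gt j) = cI j) ->
  qmodule (homog_eqc cE) gt F ->
  exists k, qmodule cE cI (rho ^+ k * dehomogenize F).
Proof.
move=> hF dE hg DE gE [_ [_ [[a ->] [s0 hs0 [s hs ->]] FE]]].
pose M := qmodule cE cI.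
have M0 : M 0 by apply: qmodule_sos; exact: sos0.
have MD p q : M p -> M q -> M (p + q) by exact: qmoduleD.
have Mr p k : M p -> M (rho ^+ k * p).
  by apply: qmoduleM; apply: sosX; exact: sos_dehom_weight.
have even_half e : ~~ odd e -> e = (e./2).*2.
  by move=> ee; rewrite -[LHS]odd_double_half (negbTE ee).
have sosr p k : sos p -> sos (rho ^+ k * p).
  by apply: sosM; apply: sosX; exact: sos_dehom_weight.
have red_sos (p : {mpoly R[n.+1]}) : sos p -> reduces (@sos R n) (grade p).
  move=> [r ->]; rewrite grade_sum; apply: reduces_sum => //; first exact: sos0.
    exact: sosD.
  by move=> q _; rewrite gradeXn; exact: reduces_sqr.
have weaken (T T' : set {mpoly R[n]}) P : (forall c, T c -> T' c) -> reduces T P -> reduces T' P.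
  by move=> TT [k [c [b [Z [Tc e]]]]]; exists k, c, b, Z; split=> //; exact: TT.
have [k [c [b [Z [Mc e]]]]] : reduces M (grade F).
  rewrite FE !gradeD !grade_sum; apply: reducesD => //.
    apply: reduces_sum => // -[x|] _; rewrite gradeM /=; last first.
      by rewrite grade_sphere; apply: weaken (reduces_chart _) => _ ->.
    (* Equality constraints may have odd degree: the ideal accepts any multiple, so the power of X
       joins the cofactor. *)
    rewrite (grade_dhomog (homogenize_dhomog _)) dehomogenize_homogenize mulrCA.
    apply: reducesC (reducesT _) => q _; apply: qmodule_ideal.
    by rewrite mulrC; apply: idealM; exact: ideal_mem.
  apply: reducesD => //.
    by apply: weaken (red_sos _ hs0) => q; exact: qmodule_sos.
  apply: reduces_sum => // j _; rewrite gradeM (grade_dhomog (hg j)) gE.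
  rewrite -mulrA; apply: (@reducesC (@sos R n)) => [q sq|]; first exact: qmodule_ineq.
  by rewrite mulrC (even_half _ (DE j)); apply: reducesXn; exact: red_sos.
rewrite (grade_dhomog hF) (even_half d dE) in e.
have [Y HY] := chart_power d./2.
exists k; set h := dehomogenize F in e *.
have : (rho ^+ k * h - rho ^+ d./2 * c)%:P + (- (rho ^+ d./2 * b))%:P * 'X
    = ((rho ^+ d./2)%:P * Z - (rho ^+ k * h)%:P * Y) * chart.
  have e2 : (rho ^+ d./2)%:P * ((rho ^+ k)%:P * (h%:P * 'X^(d./2.*2)))
      = (rho ^+ k * h)%:P + (rho ^+ k * h)%:P * Y * chart.
    transitivity ((rho ^+ k * h)%:P * ((rho ^+ d./2)%:P * 'X^(d./2.*2))).
      by rewrite rmorphM /=; ring.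
    by rewrite HY; ring.
  move: e2; rewrite e => e2.
  set A := (rho ^+ k * h)%:P in e2 *; rewrite rmorphB rmorphN !rmorphM /= -/A.
  apply/eqP; rewrite -subr_eq0; apply/eqP.
  transitivity ((A + A * Y * chart)
    - (rho ^+ d./2)%:P * (c%:P + b%:P * 'X + Z * chart)); first by ring.
  by rewrite e2 subrr.
move/chart_cancel/eqP; rewrite subr_eq0 => /eqP ->; exact: Mr.
Qed.

End Dehomogenization.

(** * Assembly *)

Section Assembly.
Context (R : realType) (n : nat) (E I : finType) (P : problem R n E I).
Context (f_ge0 : forall x, feasible P x -> 0 <= (obj P).@[x 0]).
Let d := mtdeg (obj P).
Let F := obj (homog_problem P).
Implicit Types (x : 'rV[R]_n) (y : 'rV[R]_n.+1).

Lemma fmin_le x : feasible P x -> fmin P <= (obj P).@[x 0].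
Proof.
move=> Kx; apply: ge_inf; last by exists x.
by exists 0 => _ [z Kz <-]; exact: f_ge0.
Qed.

Lemma fmin_ge0 : 0 <= fmin P.
Proof.
have [[x Kx]|K0] := pselect (exists x, feasible P x).
  apply: lb_le_inf; first by exists ((obj P).@[x 0]); exists x.
  by move=> _ [z Kz <-]; exact: f_ge0.
(* Without feasible points [inf] takes its default value 0. *)
have e0 : [set (obj P).@[x 0] | x in feasible P] = set0.
  by apply/seteqP; split => // a [x Kx _]; case: K0; exists x.
by rewrite /fmin e0 inf0.
Qed.

Lemma homog_obj_dhomog : F \is d.-homog.
Proof. by apply: rpredB; [exact: homogenize_dhomog | apply: rpredZ; exact: dhomogXn]. Qed.

Lemma dehomogenize_obj : dehomogenize F = obj P - (fmin P)%:MP.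
Proof.
rewrite /F /= dehomogenizeB dehomogenize_homogenize dehomogenizeZ dehomogenizeXn.
by rewrite dehomogenizeX0 expr1n -mul_mpolyC mulr1.
Qed.

Definition affine_point y : 'rV[R]_n := \row_i (y 0 (lift ord0 i) / y 0 ord0).

Lemma affine_pointE y i : affine_point y 0 i = y 0 (lift ord0 i) / y 0 ord0.
Proof. by rewrite mxE. Qed.

Section EvenConstraints.
Context (gt : I -> {mpoly R[n.+1]}) (D : I -> nat).
Context (hg : forall j, gt j \is (D j).-homog) (DE : forall j, ~~ odd (D j)).
Context (gE : forall j, dehomogenize (gt j) = ineqc P j) (dE : ~~ odd d).

Lemma affine_point_feasible y : y 0 ord0 != 0 ->
  (forall e, (homogenize (eqc P e)).@[y 0] = 0) -> (forall j, 0 <= (gt j).@[y 0]) ->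
  feasible P (affine_point y).
Proof.
move=> y0 he hj; split=> [e|j].
  have /eqP := he e.
  rewrite (dhomog_eval (homogenize_dhomog _) y0 (affine_pointE y)) dehomogenize_homogenize.
  by rewrite mulf_eq0 expf_eq0 (negbTE y0) andbF => /eqP.
have := hj j; rewrite (dhomog_eval (hg j) y0 (affine_pointE y)) gE pmulr_rge0 //.
by rewrite exprn_even_gt0 // y0 orbT.
Qed.

Lemma homog_objE y : y 0 ord0 != 0 ->
  F.@[y 0] = y 0 ord0 ^+ d * ((obj P).@[affine_point y 0] - fmin P).
Proof.
move=> y0; rewrite (dhomog_eval homog_obj_dhomog y0 (affine_pointE y)).
by rewrite dehomogenize_obj mevalB mevalC.
Qed.

Lemma homog_obj_ge0 y : y 0 ord0 != 0 ->
  (forall e, (homogenize (eqc P e)).@[y 0] = 0) -> (forall j, 0 <= (gt j).@[y 0]) ->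
  0 <= F.@[y 0].
Proof.
move=> y0 he hj; rewrite homog_objE // mulr_ge0 //.
  by rewrite exprn_even_ge0.
by rewrite subr_ge0 fmin_le //; exact: affine_point_feasible.
Qed.

(** The common core of both parts: points with x_0 <> 0 come from affine minimizers, so only x_0 = 0
    is left as a hypothesis. The forms [gt] may carry extra factors x_0. *)
Lemma certificate_of_infinity :
  (forall x, minimizer P x -> optimality_conditions P x) ->
  (forall y, semialg_set (homog_eqc (eqc P)) gt y -> y 0 ord0 = 0 ->
     0 <= F.@[y 0] /\ (F.@[y 0] = 0 -> local_certificate (homog_eqc (eqc P)) gt F y)) ->
  exists k p q, [/\ ideal_gen (eqc P) p, QM (ineqc P) q
    & (1 + sqnorm R n) ^+ k * obj P = p + q].
Proof.
move=> opt inf.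
have hS : ideal_gen (homog_eqc (eqc P)) (sqnorm R n.+1 - 1) by exact: (ideal_mem _ None).
have MF : qmodule (homog_eqc (eqc P)) gt F.
  apply: local_global => // y Sy.
    have [y0|y0] := eqVneq (y 0 ord0) 0; first by case: (inf y Sy y0).
    by apply: homog_obj_ge0 => // [e|j]; [exact: (Sy.1 (Some e)) | exact: Sy.2].
  have [y0|y0] := eqVneq (y 0 ord0) 0; first by case: (inf y Sy y0).
  move=> Fy; apply: (@optimality_transfer _ _ _ _ P F gt d D (fmin P) y (affine_point y)) => //.
  - exact: homog_obj_dhomog.
  - exact: dehomogenize_obj.
  - exact: affine_pointE.
  apply: opt; split.
    by apply: affine_point_feasible => // [e|j]; [exact: (Sy.1 (Some e)) | exact: Sy.2].
  move=> x Kx; apply: le_trans (fmin_le Kx).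
  have /eqP := Fy; rewrite homog_objE // mulf_eq0 expf_eq0 (negbTE y0) andbF /=.
  by rewrite subr_eq0 => /eqP ->.
have [k] := dehomogenize_certificate homog_obj_dhomog dE hg DE gE MF.
rewrite dehomogenize_obj => H.
have [p [q [Ip Qq e]]] : qmodule (eqc P) (ineqc P) (dehom_weight R n ^+ k * obj P).
  (* The certificate is for f - fmin; the constant fmin >= 0 times a power of 1 + |x|^2 is a sum of
     squares. *)
  rewrite -[obj P](subrK (fmin P)%:MP) mulrDr; apply: qmoduleD => //.
  apply: qmodule_sos; apply: sosM; last by apply: sosC; exact: fmin_ge0.
  by apply: sosX; exact: sos_dehom_weight.
by exists k, p, q; split.
Qed.

End EvenConstraints.

Lemma at_infinity_row y : y 0 ord0 = 0 ->
  y = at_infinity (\row_i y 0 (lift ord0 i)).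
Proof.
move=> y0; apply/rowP => i; case: (unliftP ord0 i) => [j|] ->.
  by rewrite at_infinityS mxE.
by rewrite at_infinity0.
Qed.

Lemma certificate_closed :
  closed_at_infinity P -> ~~ odd d -> (forall j, ~~ odd (mtdeg (ineqc P j))) ->
  (forall x, minimizer P x -> optimality_conditions P x) ->
  (forall x, minimizer_at_infinity P x ->
     optimality_conditions (homog_problem P) (at_infinity x)) ->
  exists k p q, [/\ ideal_gen (eqc P) p, QM (ineqc P) q
    & (1 + sqnorm R n) ^+ k * obj P = p + q].
Proof.
move=> clos dE DE opt optinf.
apply: (@certificate_of_infinity (fun j => homogenize (ineqc P j))
  (fun j => mtdeg (ineqc P j))) => //.
- by move=> j; exact: homogenize_dhomog.
- by move=> j; exact: dehomogenize_homogenize.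
move=> y Sy y0.
have Hy : homog_feasible P y.
  by split=> [e|j|]; [exact: (Sy.1 (Some e)) | exact: Sy.2 | rewrite y0].
split.
  (* A negative value at infinity would persist nearby, and closedness supplies a nearby feasible
     point with x_0 > 0, where F >= 0. *)
  rewrite leNgt; apply/negP => Fy.
  have : closure (homog_feasible_pos P) y by rewrite clos.
  move=> /(_ _ (meval_near_lt Fy)) [z [[[he hj _] /= z0] Fz]].
  suff : 0 <= F.@[z 0] by rewrite leNgt Fz.
  apply: (@homog_obj_ge0 (fun j => homogenize (ineqc P j))
    (fun j => mtdeg (ineqc P j))) => //.
  - by move=> j; exact: homogenize_dhomog.
  - by move=> j; exact: dehomogenize_homogenize.
  - by rewrite gt_eqF.
move=> Fy; rewrite (at_infinity_row y0) in Hy Sy Fy *.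
set x := \row_i _ in Hy Sy Fy *.
have [|_ [lam [H1 H2 H3]]] := optinf x.
  split; [split=> // | exact: Fy].
  have /eqP := Sy.1 None; rewrite mevalB meval1 meval_sqnorm subr_eq0 => /eqP; exact.
exact: (@optimality_local_certificate _ _ _ _ (homog_problem P) _ lam).
Qed.

Lemma dhomog_meval_scale (k e : nat) (p : {mpoly R[k]}) (c : R) (z : 'rV[R]_k) :
  p \is e.-homog -> p.@[(c *: z) 0] = c ^+ e * p.@[z 0].
Proof.
move=> /dhomogP hp; rewrite !mevalE mulr_sumr big_seq [RHS]big_seq.
apply: eq_bigr => m mp; rewrite mulrCA; congr (_ * _).
rewrite -(hp m mp) /= mdegE -prodrXr -big_split; apply: eq_bigr => i _.
by rewrite mxE exprMn.
Qed.

Lemma homogenize_infinity y : y 0 ord0 = 0 ->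
  (homogenize (obj P)).@[y 0] = (top_form (obj P)).@[(\row_i y 0 (lift ord0 i) : 'rV[R]_n) 0].
Proof.
move=> y0; rewrite /homogenize big_ord_recr /= subnn expr0 mul1r mevalD meval_sum.
rewrite big1 ?add0r => [|k _]; last first.
  by rewrite mevalM mevalXn mevalXU y0 expr0n subn_eq0 leqNgt ltn_ord mul0r.
rewrite comp_mpoly_meval; apply: meval_eq => i.
by rewrite tnth_mktuple mevalXU mxE.
Qed.

Lemma mtdeg0 (p : {mpoly R[n]}) : mtdeg p = 0%N -> exists c, p = c%:MP.
Proof.
move=> p0; exists (p@_0); apply/mpolyP => m; rewrite mcoeffC.
have [->|m0] := eqVneq 0%MM m; first by rewrite mulr1.
rewrite mulr0; apply: memN_msupp_eq0; apply: msize_mdeg_ge.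
apply: leq_trans (leqSpred _) _; rewrite -/(mtdeg p) p0.
by rewrite lt0n mdeg_eq0 eq_sym.
Qed.

Lemma top_form_even : pos_def_form (top_form (obj P)) -> ~~ odd d.
Proof.
(* For n = 0 positive definiteness is vacuous, but all polynomials are constant; otherwise an odd
   form would change sign under x -> -x. *)
move=> posf; have [n0|npos] := posnP n.
  suff [c fc] : exists c, obj P = c%:MP by rewrite /d /mtdeg fc msizeC; case: (c == 0).
  exists ((obj P)@_0); apply/mpolyP => m; rewrite mcoeffC.
  have -> : m = 0%MM by apply/mnmP => i; exfalso; have := leq_ltn_trans (leq0n i) (ltn_ord i); rewrite n0.
  by rewrite eqxx mulr1.
pose z : 'rV[R]_n := const_mx 1.
have zn0 : z != 0.
  by apply/eqP => /rowP/(_ (Ordinal npos))/eqP; rewrite !mxE oner_eq0.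
have := posf z zn0; have : 0 < (top_form (obj P)).@[(-1 *: z) 0].
  by apply: posf; rewrite scaler_eq0 oppr_eq0 oner_eq0.
rewrite (dhomog_meval_scale _ _ (pihomogP mdeg d (obj P))) -signr_odd -/(top_form _).
case: (odd d) => //; rewrite expr1 mulN1r; lra.
Qed.

(** In degree 0 the term fmin x_0^d does not vanish at x_0 = 0, so the positivity of F at infinity
    cannot be read off the top form. *)
Lemma certificate_constant : (0 < n)%N -> d = 0%N ->
  pos_def_form (top_form (obj P)) -> sos (obj P).
Proof.
move=> npos d0 posf; have [c fc] := mtdeg0 d0.
pose z : 'rV[R]_n := const_mx 1.
have zn0 : z != 0.
  by apply/eqP => /rowP/(_ (Ordinal npos))/eqP; rewrite !mxE oner_eq0.
have := posf z zn0; rewrite /top_form -/d d0 fc pihomog_dE; last first.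
  by rewrite -[c%:MP]mulr1 mul_mpolyC; apply: dhomogZ; exact: dhomog1.
by rewrite mevalC => /ltW; exact: sosC.
Qed.

Lemma certificate_positive : pos_def_form (top_form (obj P)) ->
  (forall x, minimizer P x -> optimality_conditions P x) ->
  exists k p q, [/\ ideal_gen (eqc P) p, QM (ineqc P) q
    & (1 + sqnorm R n) ^+ k * obj P = p + q].
Proof.
move=> posf opt; have dE := top_form_even posf.
have [/andP[npos /eqP d0]|nd] := boolP ((0 < n)%N && (d == 0%N)).
  have [p [q [Ip Qq e]]] := qmodule_sos (eqc P) (ineqc P) (certificate_constant npos d0 posf).
  by exists 0%N, p, q; split=> //; rewrite expr0 mul1r.
(* A factor x_0 makes odd degrees even. A padded constraint is void at x_0 = 0, which may add points
   at infinity to S; F is positive at all of them. *)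
pose D j := (odd (mtdeg (ineqc P j)) + mtdeg (ineqc P j))%N.
pose gt j : {mpoly R[n.+1]} :=
  'X_ord0 ^+ odd (mtdeg (ineqc P j)) * homogenize (ineqc P j).
apply: (@certificate_of_infinity gt D) => //.
- by move=> j; apply: dhomogM; [exact: dhomogXn | exact: homogenize_dhomog].
- by move=> j; rewrite /D oddD oddb addbb.
- move=> j; rewrite dehomogenizeM dehomogenizeXn dehomogenizeX0 expr1n mul1r.
  exact: dehomogenize_homogenize.
move=> y Sy y0; set x : 'rV[R]_n := \row_i y 0 (lift ord0 i).
have xn0 : x != 0.
  have y1 : \sum_i y 0 i ^+ 2 = 1.
    have /eqP := Sy.1 None; rewrite /= mevalB meval1 meval_sqnorm subr_eq0.
    by move/eqP.
  apply/eqP => x0; have : \sum_i y 0 i ^+ 2 = 0.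
    apply: big1 => i _; case: (unliftP ord0 i) => [j|] ->; last by rewrite y0 expr0n.
    by have /rowP/(_ j) := x0; rewrite !mxE => ->; rewrite expr0n.
  by rewrite y1 => /eqP; rewrite oner_eq0.
have dpos : (0 < d)%N.
  move: nd; rewrite negb_and -eqn0Ngt -lt0n => /orP[/eqP n0|//].
  case/eqP: xn0; apply/rowP => i.
  by exfalso; have := leq_ltn_trans (leq0n i) (ltn_ord i); rewrite n0.
have Fy : 0 < F.@[y 0].
  rewrite /F /= mevalB mevalZ mevalXn mevalXU y0 expr0n (gtn_eqF dpos) mulr0 subr0.
  by rewrite homogenize_infinity //; exact: posf.
by split; [exact: ltW | move=> F0; rewrite F0 ltxx in Fy].
Qed.

End Assembly.

Theorem theorem5p4 (R : realType) (n : nat) (E I : finType)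
    (f : {mpoly R[n]}) (cE : E -> {mpoly R[n]}) (cI : I -> {mpoly R[n]}) :
  real_radical (homog_eqc cE) ->
  (forall x : 'rV[R]_n, feasible (Problem f cE cI) x -> 0 <= f.@[x 0]) ->
  (closed_at_infinity (Problem f cE cI) ->
   ~~ odd (mtdeg f) ->
   (forall j : I, ~~ odd (mtdeg (cI j))) ->
   (forall x : 'rV[R]_n, minimizer (Problem f cE cI) x ->
      optimality_conditions (Problem f cE cI) x) ->
   (forall x : 'rV[R]_n, minimizer_at_infinity (Problem f cE cI) x ->
      optimality_conditions (homog_problem (Problem f cE cI)) (at_infinity x)) ->
   exists k : nat, exists p q : {mpoly R[n]},
     [/\ ideal_gen cE p, QM cI q & (1 + sqnorm R n) ^+ k * f = p + q])
  /\
  (pos_def_form (top_form f) ->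
   (forall x : 'rV[R]_n, minimizer (Problem f cE cI) x ->
      optimality_conditions (Problem f cE cI) x) ->
   exists k : nat, exists p q : {mpoly R[n]},
     [/\ ideal_gen cE p, QM cI q & (1 + sqnorm R n) ^+ k * f = p + q]).
Proof.
move=> _ f0; split; first exact: (@certificate_closed _ _ _ _ (Problem f cE cI)).
exact: (@certificate_positive _ _ _ _ (Problem f cE cI)).
Qed.
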